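(* Let $M\in\mathcal{A}$. (a) The set $\Sigma(M)$ is a rational generalized fan in $K_0(\mathcal{A})_{\mathbb{R}}^*$ which is finite and complete. Moreover, there are mutually inverse bijections $\mathsf{TF}(M)\simeq\Sigma(M)$ given by $E\mapsto\overline{E}$ for $E\in\mathsf{TF}(M)$ and $\sigma\mapsto\sigma^\circ$ for $\sigma\in\Sigma(M)$. (b) Let $\sigma\in\Sigma(M)$. Then the face decomposition $\sigma=\bigsqcup_{\tau\in\mathsf{Face}\,\sigma}\tau^\circ$ is also the decomposition of $\sigma$ into $M$-TF equivalence classes.
   Context: $\mathcal{A}$ is an abelian length category (every object has finite length) with only finitely many isoclasses $S(1),\ldots,S(n)$ of simple objects. $K_0(\mathcal{A})_{\mathbb{R}}=K_0(\mathcal{A})\otimes_{\mathbb{Z}}\mathbb{R}=\bigoplus_{i=1}^n\mathbb{R}[S(i)]\simeq\mathbb{R}^n$, and $K_0(\mathcal{A})_{\mathbb{R}}^*=\operatorname{Hom}_{\mathbb{R}}(K_0(\mathcal{A})_{\mathbb{R}},\mathbb{R})=\bigoplus_{i=1}^n\mathbb{R}[S(i)]^*\simeq\mathbb{R}^n$ with the dual basis $[S(i)]^*$ and the Euclidean topology. For $\theta\in K_0(\mathcal{A})_{\mathbb{R}}^*$ and $X\in\mathcal{A}$, write $\theta(X):=\theta([X])$. Semistable torsion pairs. For $\theta\in K_0(\mathcal{A})_{\mathbb{R}}^*$ define full subcategories of $\mathcal{A}$: $\overline{\mathcal{T}}_\theta$ = objects $X$ with $\theta(N)\ge0$ for every factor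 object $N$ of $X$; $\mathcal{F}_\theta$ = objects $X$ with $\theta(L)<0$ for every nonzero subobject $L$ of $X$; $\mathcal{T}_\theta$ = objects $X$ with $\theta(N)>0$ for every nonzero factor object $N$ of $X$; $\overline{\mathcal{F}}_\theta$ = objects $X$ with $\theta(L)\le0$ for every subobject $L$ of $X$. Then $(\overline{\mathcal{T}}_\theta,\mathcal{F}_\theta)$ and $(\mathcal{T}_\theta,\overline{\mathcal{F}}_\theta)$ are torsion pairs, and $\mathcal{W}_\theta:=\overline{\mathcal{T}}_\theta\cap\overline{\mathcal{F}}_\theta$ is a wide subcategory of $\mathcal{A}$, which is an abelian category of finite length. For $M\in\mathcal{A}$, $\overline{\mathrm{t}}_\theta M$ (resp. $\mathrm{t}_\theta M$) is the largest subobject of $M$ lying in $\overline{\mathcal{T}}_\theta$ (resp. $\mathcal{T}_\theta$), $\mathrm{f}_\theta M:=M/\overline{\mathrm{t}}_\theta M\in\mathcal{F}_\theta$, $\overline{\mathrm{f}}_\theta M:=M/\mathrm{t}_\theta M\in\overline{\mathcal{F}}_\theta$, and $\mathrm{w}_\theta M:=\overline{\mathrm{t}}_\theta M/\mathrm{t}_\theta M\in\mathcal{W}_\theta$. For $X\in\mathcal{W}_\theta$, $\mathsf{supp}_\theta X$ is the set of isoclasses of composition factors of $X$ in $\mathcal{W}_\theta$. $M$-TF equivalence. Elements $\theta,\eta\in K_0(\mathcal{A})_{\mathbb{R}}^*$ are $M$-TF equivalent if (i) $\mathrm{t}_\theta M=\mathrm{t}_\eta M$, $\mathrm{w}_\theta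 M=\mathrm{w}_\eta M$ and $\mathrm{f}_\theta M=\mathrm{f}_\eta M$ (equivalently $\mathrm{t}_\theta M=\mathrm{t}_\eta M$ and $\overline{\mathrm{t}}_\theta M=\overline{\mathrm{t}}_\eta M$ as subobjects of $M$), and (ii) $\mathsf{supp}_\theta(\mathrm{w}_\theta M)=\mathsf{supp}_\eta(\mathrm{w}_\eta M)$. $\mathsf{TF}(M)$ is the set of $M$-TF equivalence classes, and $\Sigma(M):=\{\overline{E}\mid E\in\mathsf{TF}(M)\}$ is the set of their closures. Fans. A (rational) polyhedral cone is a set $\sum_{i=1}^m\mathbb{R}_{\ge0}v_i$ with finitely many vectors $v_i$ (resp. finitely many lattice vectors, the lattice being $\bigoplus_i\mathbb{Z}[S(i)]^*$); cones need not be strongly convex. $\mathsf{Face}\,\sigma$ is the set of all (nonempty) faces of $\sigma$, including $\sigma$ itself. $\sigma^\circ$ is the relative interior, i.e. the interior of $\sigma$ in its linear span $\mathbb{R}\sigma$. A generalized fan is a set $\Sigma$ of polyhedral cones such that $\mathsf{Face}\,\sigma\subset\Sigma$ for all $\sigma\in\Sigma$ and $\sigma\cap\tau\in\mathsf{Face}\,\sigma\cap\mathsf{Face}\,\tau$ for all $\sigma,\tau\in\Sigma$. It is rational if all its cones are rational, finite if it is a finite set, complete if the union of its cones is the whole space. *)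

(* Defs.v *)
From HB Require Import structures.
From mathcomp Require Import all_boot all_order all_algebra.
From mathcomp Require Import all_classical all_reals all_analysis.
From mathcomp Require Import ring_quotient freeg.

Set Implicit Arguments.
Unset Strict Implicit.
Unset Printing Implicit Defensive.

Import Order.TTheory GRing.Theory Num.Theory.
Import numFieldNormedType.Exports.

Local Open Scope classical_set_scope.
Local Open Scope ring_scope.

Record preadd_cat := PreaddCat {
  ob :> Type;
  mor : ob -> ob -> zmodType;
  idm : forall X, mor X X;
  compm : forall X Y Z, mor Y Z -> mor X Y -> mor X Z;
  compA : forall X Y Z T (h : mor Z T) (g : mor Y Z) (f : mor X Y),
    compm h (compm g f) = compm (compm h g) f;
  comp1m : forall X Y (f : mor X Y), compm (idm Y) f = f;
  compm1 : forall X Y (f : mor X Y), compm f (idm X) = f;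
  compDl : forall X Y Z (g g' : mor Y Z) (f : mor X Y),
    compm (g + g') f = compm g f + compm g' f;
  compDr : forall X Y Z (g : mor Y Z) (f f' : mor X Y),
    compm g (f + f') = compm g f + compm g f'
}.

Arguments mor {p} _ _.
Arguments idm {p} _.
Arguments compm {p X Y Z} _ _.

Notation "g \oc f" := (compm g f) (at level 40, left associativity).

Definition fullsub (C : preadd_cat) (P : set C) : preadd_cat :=
  @PreaddCat {X : C | P X} (fun X Y => mor (sval X) (sval Y))
    (fun X => idm (sval X)) (fun X Y Z g f => g \oc f)
    (fun X Y Z T h g f => compA h g f)
    (fun X Y f => comp1m f) (fun X Y f => compm1 f)
    (fun X Y Z g g' f => compDl g g' f) (fun X Y Z g f f' => compDr g f f').

Definition mono (C : preadd_cat) (X Y : C) (f : mor X Y) : Prop :=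
  forall (Z : C) (u v : mor Z X), f \oc u = f \oc v -> u = v.

Definition epi (C : preadd_cat) (X Y : C) (f : mor X Y) : Prop :=
  forall (Z : C) (u v : mor Y Z), u \oc f = v \oc f -> u = v.

Definition is_iso (C : preadd_cat) (X Y : C) (f : mor X Y) : Prop :=
  exists g : mor Y X, g \oc f = idm X /\ f \oc g = idm Y.

Definition isomorphic (C : preadd_cat) (X Y : C) : Prop :=
  exists f : mor X Y, is_iso f.

Definition is_zero (C : preadd_cat) (Z : C) : Prop :=
  forall X : C, (forall f : mor X Z, f = 0) /\ (forall f : mor Z X, f = 0).

Definition is_kernel (C : preadd_cat) (K X Y : C)
    (k : mor K X) (f : mor X Y) : Prop :=
  f \oc k = 0 /\
  forall (Z : C) (u : mor Z X), f \oc u = 0 ->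
    exists! v : mor Z K, k \oc v = u.

Definition is_cokernel (C : preadd_cat) (X Y Q : C)
    (q : mor Y Q) (f : mor X Y) : Prop :=
  q \oc f = 0 /\
  forall (Z : C) (u : mor Y Z), u \oc f = 0 ->
    exists! v : mor Q Z, v \oc q = u.

Definition is_biproduct (C : preadd_cat) (X Y P : C)
    (iX : mor X P) (iY : mor Y P) (pX : mor P X) (pY : mor P Y) : Prop :=
  [/\ pX \oc iX = idm X, pY \oc iY = idm Y, pX \oc iY = 0, pY \oc iX = 0
    & iX \oc pX + iY \oc pY = idm P].

Record abelian (C : preadd_cat) : Prop := Abelian {
  ab_zero : exists Z : C, is_zero Z;
  ab_biproduct : forall X Y : C, exists (P : C) (iX : mor X P) (iY : mor Y P)
    (pX : mor P X) (pY : mor P Y), is_biproduct iX iY pX pY;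
  ab_kernel : forall (X Y : C) (f : mor X Y),
    exists (K : C) (k : mor K X), is_kernel k f;
  ab_cokernel : forall (X Y : C) (f : mor X Y),
    exists (Q : C) (q : mor Y Q), is_cokernel q f;
  ab_mono_normal : forall (X Y : C) (f : mor X Y), mono f ->
    exists (Z : C) (g : mor Y Z), is_kernel f g;
  ab_epi_normal : forall (X Y : C) (f : mor X Y), epi f ->
    exists (Z : C) (g : mor Z X), is_cokernel f g
}.

Definition short_exact (C : preadd_cat) (X Y Z : C)
    (f : mor X Y) (g : mor Y Z) : Prop :=
  is_kernel f g /\ is_cokernel g f.

Definition simple_ob (C : preadd_cat) (T : C) : Prop :=
  ~ is_zero T /\
  forall (L : C) (i : mor L T), mono i -> is_zero L \/ is_iso i.

(* The sequence lists the successive factors of a composition series, from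
   the bottom up. *)
Inductive comp_series (C : preadd_cat) : C -> seq C -> Prop :=
| comp_series_zero (X : C) of is_zero X : comp_series X [::]
| comp_series_ext (X Y T : C) (f : mor X Y) (g : mor Y T) (s : seq C)
    of short_exact f g & simple_ob T & comp_series X s :
    comp_series Y (rcons s T).

Definition finite_length (C : preadd_cat) : Prop :=
  forall X : C, exists s, comp_series X s.

Definition comp_factor (C : preadd_cat) (T X : C) : Prop :=
  exists s, comp_series X s /\
    exists2 i, (i < size s)%N & isomorphic T (nth T s i).

Definition simple_reps (C : preadd_cat) (n : nat) (S : 'I_n -> C) : Prop :=
  [/\ forall i, simple_ob (S i),
      forall i j, isomorphic (S i) (S j) -> i = j
    & forall T, simple_ob T -> exists i, isomorphic T (S i)].

Definition K0_relations (C : preadd_cat) : set {freeg {classic C}} :=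
  [set x | exists (X Y Z : C) (f : mor X Y) (g : mor Y Z), short_exact f g /\
     x = << (Y : {classic C}) >> - << (X : {classic C}) >>
         - << (Z : {classic C}) >>].

Definition K0_span (C : preadd_cat) : {pred {freeg {classic C}}} :=
  fun x => `[< forall H : {pred {freeg {classic C}}}, zmod_closed H ->
               (forall y, K0_relations y -> y \in H) -> x \in H >].

Lemma K0_span_zmod_closed (C : preadd_cat) : zmod_closed (@K0_span C).
Proof.
split=> [|x y /asboolP hx /asboolP hy]; apply/asboolP => H Hcl HR.
  by have [] := Hcl.
have [_ HB] := Hcl; apply: HB; [exact: hx | exact: hy].
Qed.

HB.instance Definition _ (C : preadd_cat) :=
  GRing.isZmodClosed.Build {freeg {classic C}} (@K0_span C)
    (@K0_span_zmod_closed C).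

Definition K0 (C : preadd_cat) : zmodType := Quotient.quot (@K0_span C).

Definition K0_class (C : preadd_cat) (X : C) : K0 C :=
  (\pi_(Quotient.quot (@K0_span C)) << (X : {classic C}) >>)%qT.

(* R-linear forms on the real Grothendieck group K_0(C)_R are the same as
   additive maps K_0(C) -> R. *)
Definition K0_dual (C : preadd_cat) (R : realType) : Type :=
  {additive K0 C -> R}.

Definition pairing (C : preadd_cat) (R : realType) (theta : K0_dual C R)
  (X : C) : R := (theta : {additive K0 C -> R}) (K0_class X).

(* The functional \sum_i x_i [S i]^* : its value at [S i] is x_i, which
   determines it when the [S i] form a basis of K_0. *)
Definition of_coord (C : preadd_cat) (R : realType) (n : nat) (S : 'I_n -> C)
    (x : 'rV[R]_n) : K0_dual C R :=
  xget (\0 : {classic {additive K0 C -> R}})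
       [set theta : K0_dual C R | forall i, pairing theta (S i) = x 0 i].

Definition Tbar (C : preadd_cat) (R : realType) (theta : K0_dual C R) : set C :=
  [set X | forall (N : C) (p : mor X N), epi p -> 0 <= pairing theta N].

Definition Tss (C : preadd_cat) (R : realType) (theta : K0_dual C R) : set C :=
  [set X | forall (N : C) (p : mor X N), epi p -> ~ is_zero N ->
     0 < pairing theta N].

Definition Fbar (C : preadd_cat) (R : realType) (theta : K0_dual C R) : set C :=
  [set X | forall (L : C) (i : mor L X), mono i -> pairing theta L <= 0].

Definition Wss (C : preadd_cat) (R : realType) (theta : K0_dual C R) : set C :=
  Tbar theta `&` Fbar theta.

Record subobject (C : preadd_cat) (M : C) := Subobject {
  sub_ob : C;
  sub_mor : mor sub_ob M;
  sub_mono : mono sub_mor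
}.

Lemma idm_mono (C : preadd_cat) (M : C) : mono (idm M).
Proof. by move=> Z u v; rewrite !comp1m. Qed.

Definition sub_full (C : preadd_cat) (M : C) : subobject M :=
  Subobject (@idm_mono C M).

Definition sub_le (C : preadd_cat) (M : C) (U V : subobject M) : Prop :=
  exists h : mor (sub_ob U) (sub_ob V), sub_mor V \oc h = sub_mor U.

Definition sub_eq (C : preadd_cat) (M : C) (U V : subobject M) : Prop :=
  sub_le U V /\ sub_le V U.

Definition largest_in (C : preadd_cat) (P : set C) (M : C) : set (subobject M) :=
  [set U | P (sub_ob U) /\
     forall V : subobject M, P (sub_ob V) -> sub_le V U].

(* Representatives: the largest subobject is determined up to [sub_eq]. *)
Definition tors (C : preadd_cat) (R : realType) (theta : K0_dual C R) (M : C) :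
    subobject M :=
  xget (sub_full M : {classic subobject M}) (@largest_in C (Tss theta) M).

Definition torsbar (C : preadd_cat) (R : realType) (theta : K0_dual C R)
    (M : C) : subobject M :=
  xget (sub_full M : {classic subobject M}) (@largest_in C (Tbar theta) M).

(* A representative of torsbar / tors, determined up to isomorphism. *)
Definition wss (C : preadd_cat) (R : realType) (theta : K0_dual C R) (M : C) :
    C :=
  xget (M : {classic C})
    [set W : C | exists (h : mor (sub_ob (tors theta M))
                             (sub_ob (torsbar theta M)))
                        (q : mor (sub_ob (torsbar theta M)) W),
       sub_mor (torsbar theta M) \oc h = sub_mor (tors theta M) /\
       is_cokernel q h].

(* A set of isoclasses is encoded as an isomorphism-closed set of objects;
   composition factors are taken inside the category W_theta. *)
Definition supp (C : preadd_cat) (R : realType) (theta : K0_dual C R) (X : C) :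
    set C :=
  [set T | exists (hT : Wss theta T) (hX : Wss theta X),
     @comp_factor (fullsub (Wss theta)) (exist _ T hT) (exist _ X hX)].

Definition TF_equiv (C : preadd_cat) (R : realType) (M : C)
    (theta eta : K0_dual C R) : Prop :=
  [/\ sub_eq (tors theta M) (tors eta M),
      sub_eq (torsbar theta M) (torsbar eta M)
    & supp theta (wss theta M) = supp eta (wss eta M)].

Definition TF (C : preadd_cat) (R : realType) (n : nat) (S : 'I_n -> C)
    (M : C) : set (set 'rV[R]_n) :=
  [set E | exists x : 'rV[R]_n,
     E = [set y | TF_equiv M (of_coord S x) (of_coord S y)]].

Arguments TF {C} R {n} S M.

Definition Sigma (C : preadd_cat) (R : realType) (n : nat) (S : 'I_n -> C)
    (M : C) : set (set 'rV[R]_n) :=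
  [set closure E | E in TF R S M].

Arguments Sigma {C} R {n} S M.

Definition cone_of (R : realType) (n m : nat) (v : 'I_m -> 'rV[R]_n) :
    set 'rV[R]_n :=
  [set x | exists2 c : 'I_m -> R, (forall i, 0 <= c i) &
     x = \sum_(i < m) c i *: v i].

Definition polyhedral_cone (R : realType) (n : nat) (sigma : set 'rV[R]_n) :
    Prop :=
  exists (m : nat) (v : 'I_m -> 'rV[R]_n), sigma = cone_of v.

Definition rational_cone (R : realType) (n : nat) (sigma : set 'rV[R]_n) :
    Prop :=
  exists (m : nat) (v : 'I_m -> 'rV[int]_n),
    sigma = cone_of (fun i => map_mx intr (v i)).

(* The faces of sigma are its intersections with {u = 0}, for the linear forms
   u nonnegative on sigma; u = 0 yields sigma itself. *)
Definition Face (R : realType) (n : nat) (sigma : set 'rV[R]_n) :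
    set (set 'rV[R]_n) :=
  [set tau | exists u : 'cV[R]_n,
     (forall x, sigma x -> 0 <= (x *m u) 0 0) /\
     tau = [set x | sigma x /\ (x *m u) 0 0 = 0]].

Definition linspan (R : realType) (n : nat) (sigma : set 'rV[R]_n) :
    set 'rV[R]_n :=
  [set x | exists (m : nat) (c : 'I_m -> R) (v : 'I_m -> 'rV[R]_n),
     (forall i, sigma (v i)) /\ x = \sum_(i < m) c i *: v i].

Definition relint (R : realType) (n : nat) (sigma : set 'rV[R]_n) :
    set 'rV[R]_n :=
  [set x | linspan sigma x /\ \forall y \near x, linspan sigma y -> sigma y].

Definition generalized_fan (R : realType) (n : nat)
    (Sig : set (set 'rV[R]_n)) : Prop :=
  [/\ forall sigma, Sig sigma -> polyhedral_cone sigma,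
      forall sigma, Sig sigma -> Face sigma `<=` Sig
    & forall sigma tau, Sig sigma -> Sig tau ->
        (Face sigma `&` Face tau) (sigma `&` tau)].

Definition rational_fan (R : realType) (n : nat)
    (Sig : set (set 'rV[R]_n)) : Prop :=
  generalized_fan Sig /\ forall sigma, Sig sigma -> rational_cone sigma.

Definition complete_fan (R : realType) (n : nat)
    (Sig : set (set 'rV[R]_n)) : Prop :=
  \bigcup_(sigma in Sig) sigma = setT.

(* Main.v *)
Require Import Defs.
From HB Require Import structures.
From mathcomp Require Import all_boot all_order all_algebra.
From mathcomp Require Import all_classical all_reals all_analysis.
From mathcomp Require Import ring_quotient freeg zify ring lra.
Import Order.TTheory GRing.Theory Num.Theory.
Import numFieldNormedType.Exports.
Local Open Scope classical_set_scope.
Local Open Scope ring_scope.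
Set Implicit Arguments.
Unset Strict Implicit.
Unset Printing Implicit Defensive.

(** Write V for the set of classes [L] of subobjects L of M.  Each [L] lies
    between 0 and [M], so V is a finite set of lattice points, and Sigma(M)
    turns out to be the normal fan of its convex hull (the Newton polytope of M).

    Algebra.  A form theta is additive on short exact sequences, hence modular
    on subobjects: theta(U) + theta(W) = theta(I) + theta(J), where I and J are
    the intersection and the sum of U and W ([modular_law]).  Therefore the
    subobjects of M on which theta is maximal are closed under intersections
    and sums; the least one is t_theta M and the greatest one is tbar_theta M
    ([tors_maximizer], [torsbar_maximizer]).  Since theta takes nonpositive
    values on subobjects of the semistable object w_theta M, a subobject X of it
    lies in W_theta exactly when theta(X) = 0; lifted to M, these X are exactly
    the maximizers of theta.  So two forms with the same maximizers have the same
    torsion data and the same stable composition factors ([supp_transfer]).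
    Conversely, if the torsion data and the supports agree, then a
    theta-maximizer L gives X = L / t_theta M whose theta-stable factors are all
    annihilated by eta, so eta(X) = 0 and L is an eta-maximizer
    ([pairing_of_supp]).  Hence M-TF equivalence means having the same set of
    maximizers ([TF_equiv_maximizes]), that is, attaining the maximum over V at
    the same points of V ([TF_equiv_argmax]).  Passing to V requires coordinates
    on K_0, which the Jordan-Hoelder theorem provides ([jordan_holder],
    [K0_dual_lift], [pairing_of_coord]).

    Convexity.  The rest holds for every finite nonempty family of lattice
    points.  If F is the set of maximizing points for x, the class of x is cut
    out by the equations and strict inequalities expressing that the maximum is
    attained exactly on F; relaxing the strict inequalities gives its closure, the
    cone C_F of the y that attain their maximum on all of F
    ([closure_argmax_class]), and the relative interior of C_F is the class again
    ([relint_argmax_class]).  The faces of C_F are the C_G with G an argmax set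
    containing F ([face_normal_cone], [Face_normal_coneP]).  That C_F, given by
    integral inequalities, is generated by integral vectors is the
    Minkowski-Weyl theorem, proved by adding one inequality at a time
    ([int_cone_halfspace]). *)

Local Notation compA := Defs.compA.

(** * Kernels, cokernels and composition series in preadditive categories *)

Section Preadditive.
Variable C : preadd_cat.
Implicit Types X Y Z : C.

Lemma comp0m X Y Z (f : mor X Y) : (0 : mor Y Z) \oc f = 0.
Proof. by apply: (addrI (0 \oc f)); rewrite -compDl !addr0. Qed.

Lemma compm0 X Y Z (g : mor Y Z) : g \oc (0 : mor X Y) = 0.
Proof. by apply: (addrI (g \oc 0)); rewrite -compDr !addr0. Qed.

Lemma compNm X Y Z (g : mor Y Z) (f : mor X Y) : (- g) \oc f = - (g \oc f).
Proof. by apply: (addrI (g \oc f)); rewrite -compDl !subrr comp0m. Qed.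

Lemma compmN X Y Z (g : mor Y Z) (f : mor X Y) : g \oc (- f) = - (g \oc f).
Proof. by apply: (addrI (g \oc f)); rewrite -compDr !subrr compm0. Qed.

Lemma compBl X Y Z (g g' : mor Y Z) (f : mor X Y) :
  (g - g') \oc f = g \oc f - g' \oc f.
Proof. by rewrite compDl compNm. Qed.

Lemma compBr X Y Z (g : mor Y Z) (f f' : mor X Y) :
  g \oc (f - f') = g \oc f - g \oc f'.
Proof. by rewrite compDr compmN. Qed.

Lemma monoP X Y (f : mor X Y) :
  mono f <-> forall Z (u : mor Z X), f \oc u = 0 -> u = 0.
Proof.
split=> [mf Z u fu|h Z u v fuv]; first by apply: mf; rewrite fu compm0.
by apply/subr0_eq/h; rewrite compBr fuv subrr.
Qed.

Lemma epiP X Y (f : mor X Y) :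
  epi f <-> forall Z (u : mor Y Z), u \oc f = 0 -> u = 0.
Proof.
split=> [ef Z u uf|h Z u v ufv]; first by apply: ef; rewrite uf comp0m.
by apply/subr0_eq/h; rewrite compBl ufv subrr.
Qed.

Lemma mono_comp X Y Z (g : mor Y Z) (f : mor X Y) :
  mono g -> mono f -> mono (g \oc f).
Proof. by move=> mg mf T u v; rewrite -!compA => /mg /mf. Qed.

Lemma epi_comp X Y Z (g : mor Y Z) (f : mor X Y) :
  epi g -> epi f -> epi (g \oc f).
Proof. by move=> eg ef T u v; rewrite !compA => /ef /eg. Qed.

Lemma mono_cancel X Y Z (g : mor Y Z) (f : mor X Y) : mono (g \oc f) -> mono f.
Proof. by move=> m T u v fuv; apply: m; rewrite -!compA fuv. Qed.

Lemma epi_cancel X Y Z (g : mor Y Z) (f : mor X Y) : epi (g \oc f) -> epi g.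
Proof. by move=> m T u v fuv; apply: m; rewrite !compA fuv. Qed.

Lemma idm_epi X : epi (idm X).
Proof. by move=> Z u v; rewrite !compm1. Qed.

Lemma iso_mono X Y (f : mor X Y) : is_iso f -> mono f.
Proof.
by move=> [g [gf _]] Z u v fuv; rewrite -(comp1m u) -(comp1m v) -gf -!compA fuv.
Qed.

Lemma iso_epi X Y (f : mor X Y) : is_iso f -> epi f.
Proof.
by move=> [g [_ fg]] Z u v fuv; rewrite -(compm1 u) -(compm1 v) -fg !compA fuv.
Qed.

Lemma isomorphic_refl X : isomorphic X X.
Proof. by exists (idm X), (idm X); rewrite comp1m. Qed.

Lemma isomorphic_sym X Y : isomorphic X Y -> isomorphic Y X.
Proof. by move=> [f [g [gf fg]]]; exists g, f. Qed.

Lemma isomorphic_trans X Y Z :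
  isomorphic X Y -> isomorphic Y Z -> isomorphic X Z.
Proof.
move=> [f [g [gf fg]]] [h [k [kh hk]]]; exists (h \oc f), (g \oc k); split.
  by rewrite compA -(compA g) kh compm1.
by rewrite compA -(compA h) fg compm1.
Qed.

Lemma is_zeroP X : is_zero X <-> idm X = 0.
Proof.
split=> [zX|h Y]; [by have [h _] := zX X; exact: h|split=> f].
  by rewrite -(comp1m f) h comp0m.
by rewrite -(compm1 f) h compm0.
Qed.

Lemma mono_is_zero X Y (f : mor X Y) : mono f -> is_zero Y -> is_zero X.
Proof.
move=> mf zY; apply/is_zeroP; apply: mf; rewrite compm0.
by have [h _] := zY X; exact: h.
Qed.

Lemma epi_is_zero X Y (f : mor X Y) : epi f -> is_zero X -> is_zero Y.
Proof.
move=> mf zX; apply/is_zeroP; apply: mf; rewrite comp0m.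
by have [_ h] := zX Y; exact: h.
Qed.

Lemma isomorphic_is_zero X Y : isomorphic X Y -> is_zero X -> is_zero Y.
Proof. by move=> [f /iso_epi]; exact: epi_is_zero. Qed.

Lemma kernel_mono K X Y (k : mor K X) (f : mor X Y) : is_kernel k f -> mono k.
Proof.
move=> [fk h] Z u v kuv; have [] := h Z (k \oc u).
  by rewrite compA fk comp0m.
by move=> w [_ uniq]; rewrite -(uniq u)// -(uniq v).
Qed.

Lemma cokernel_epi X Y Q (q : mor Y Q) (f : mor X Y) : is_cokernel q f -> epi q.
Proof.
move=> [qf h] Z u v kuv; have [] := h Z (u \oc q).
  by rewrite -compA qf compm0.
by move=> w [_ uniq]; rewrite -(uniq u)// -(uniq v).
Qed.

Lemma kernel_lift K X Y (k : mor K X) (f : mor X Y) : is_kernel k f ->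
  forall Z (u : mor Z X), f \oc u = 0 -> exists v, k \oc v = u.
Proof. by move=> [_ h] Z u /h[v [] ? _]; exists v. Qed.

Lemma cokernel_lift X Y Q (q : mor Y Q) (f : mor X Y) : is_cokernel q f ->
  forall Z (u : mor Y Z), u \oc f = 0 -> exists v, v \oc q = u.
Proof. by move=> [_ h] Z u /h[v [] ? _]; exists v. Qed.

Lemma kernelI K X Y (k : mor K X) (f : mor X Y) : mono k -> f \oc k = 0 ->
  (forall Z (u : mor Z X), f \oc u = 0 -> exists v, k \oc v = u) ->
  is_kernel k f.
Proof.
move=> mk fk h; split=> // Z u /h[v kv]; exists v; split=> // v' kv'.
by apply: mk; rewrite kv.
Qed.

Lemma cokernelI X Y Q (q : mor Y Q) (f : mor X Y) : epi q -> q \oc f = 0 ->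
  (forall Z (u : mor Y Z), u \oc f = 0 -> exists v, v \oc q = u) ->
  is_cokernel q f.
Proof.
move=> mk fk h; split=> // Z u /h[v kv]; exists v; split=> // v' kv'.
by apply: mk; rewrite kv.
Qed.

Lemma kernel_isomorphic K K' X Y (k : mor K X) (k' : mor K' X) (f : mor X Y) :
  is_kernel k f -> is_kernel k' f -> exists2 h : mor K' K, is_iso h & k \oc h = k'.
Proof.
move=> kk kk'.
have [h kh] := kernel_lift kk kk'.1; have [h' kh'] := kernel_lift kk' kk.1.
exists h => //; exists h'; split.
  by apply: (kernel_mono kk'); rewrite compA kh' kh compm1.
by apply: (kernel_mono kk); rewrite compA kh kh' compm1.
Qed.

Lemma cokernel_isomorphic X Y Q Q' (q : mor Y Q) (q' : mor Y Q') (f : mor X Y) :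
  is_cokernel q f -> is_cokernel q' f ->
  exists2 h : mor Q Q', is_iso h & h \oc q = q'.
Proof.
move=> kk kk'.
have [h kh] := cokernel_lift kk kk'.1; have [h' kh'] := cokernel_lift kk' kk.1.
exists h => //; exists h'; split.
  by apply: (cokernel_epi kk); rewrite -compA kh kh' comp1m.
by apply: (cokernel_epi kk'); rewrite -compA kh' kh comp1m.
Qed.

Lemma iso_kernel K K' X Y (k : mor K X) (f : mor X Y) (h : mor K' K) :
  is_kernel k f -> is_iso h -> is_kernel (k \oc h) f.
Proof.
move=> kk ih; apply: kernelI.
- exact: mono_comp (kernel_mono kk) (iso_mono ih).
- by rewrite compA kk.1 comp0m.
- move=> Z u /(kernel_lift kk)[v <-]; have [h' [_ hh']] := ih.
  by exists (h' \oc v); rewrite compA -(compA k) hh' compm1.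
Qed.

Lemma iso_cokernel X Y Q Q' (q : mor Y Q) (f : mor X Y) (h : mor Q Q') :
  is_cokernel q f -> is_iso h -> is_cokernel (h \oc q) f.
Proof.
move=> kk ih; apply: cokernelI.
- exact: epi_comp (iso_epi ih) (cokernel_epi kk).
- by rewrite -compA kk.1 compm0.
- move=> Z u /(cokernel_lift kk)[v <-]; have [h' [h'h _]] := ih.
  by exists (v \oc h'); rewrite compA -(compA v) h'h compm1.
Qed.

Lemma short_exact_iso_mid X Y Y' Z (f : mor X Y) (g : mor Y Z) (h : mor Y Y')
    (h' : mor Y' Y) : h' \oc h = idm Y -> h \oc h' = idm Y' ->
  short_exact f g -> short_exact (h \oc f) (g \oc h').
Proof.
move=> h'h hh' [kf cg].
have ih : is_iso h by exists h'.
have ih' : is_iso h' by exists h.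
have e0 : (g \oc h') \oc (h \oc f) = 0.
  by rewrite compA -(compA g) h'h compm1 kf.1.
split; [apply: kernelI => //|apply: cokernelI => //].
- exact: mono_comp (iso_mono ih) (kernel_mono kf).
- move=> T u gu; have /(kernel_lift kf)[v fv] : g \oc (h' \oc u) = 0.
    by rewrite compA.
  by exists v; rewrite -compA fv compA hh' comp1m.
- exact: epi_comp (cokernel_epi cg) (iso_epi ih').
- move=> T u gu; have /(cokernel_lift cg)[v fv] : (u \oc h) \oc f = 0.
    by rewrite -compA.
  by exists v; rewrite compA fv -compA hh' compm1.
Qed.

Lemma comp_series_iso X Y s : isomorphic X Y -> comp_series X s -> comp_series Y s.
Proof.
move=> iXY cs; elim: cs Y iXY => {X s} [X zX Y iXY|X Y T f g s se sT cX _ Y'].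
  by apply: comp_series_zero; exact: isomorphic_is_zero zX.
by move=> [h [h' [h'h hh']]]; apply: comp_series_ext (short_exact_iso_mid h'h hh' se) sT cX.
Qed.

End Preadditive.

(** * Factorizations and pullbacks in abelian categories *)

Section Abelian.
Variables (C : preadd_cat) (abC : abelian C).
Implicit Types X Y Z : C.

Lemma mono_is_kernel X Y Q (f : mor X Y) (q : mor Y Q) :
  mono f -> is_cokernel q f -> is_kernel f q.
Proof.
move=> mf cq; apply: kernelI => //; first exact: cq.1.
move=> Z u qu; have [T [g kg]] := ab_mono_normal abC mf.
apply: (kernel_lift kg); have [g' <-] := cokernel_lift cq kg.1.
by rewrite -compA qu compm0.
Qed.

Lemma epi_is_cokernel K X Y (k : mor K X) (f : mor X Y) :
  epi f -> is_kernel k f -> is_cokernel f k.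
Proof.
move=> ef kk; apply: cokernelI => //; first exact: kk.1.
move=> Z u uk; have [T [g cg]] := ab_epi_normal abC ef.
apply: (cokernel_lift cg); have [g' <-] := kernel_lift kk cg.1.
by rewrite compA uk comp0m.
Qed.

Lemma mono_cokernel_exact X Y Q (f : mor X Y) (q : mor Y Q) :
  mono f -> is_cokernel q f -> short_exact f q.
Proof. by move=> mf cq; split=> //; exact: mono_is_kernel. Qed.

Lemma epi_kernel_exact K X Y (k : mor K X) (f : mor X Y) :
  epi f -> is_kernel k f -> short_exact k f.
Proof. by move=> mf cq; split=> //; exact: epi_is_cokernel. Qed.

Lemma mono_short_exact X Y (f : mor X Y) : mono f ->
  exists (Q : C) (q : mor Y Q), short_exact f q.
Proof.
move=> mf; have [Q [q cq]] := ab_cokernel abC f.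
by exists Q, q; exact: mono_cokernel_exact.
Qed.

Lemma epi_short_exact X Y (f : mor X Y) : epi f ->
  exists (K : C) (k : mor K X), short_exact k f.
Proof.
move=> mf; have [Q [q cq]] := ab_kernel abC f.
by exists Q, q; exact: epi_kernel_exact.
Qed.

Lemma mono_epi_iso X Y (f : mor X Y) : mono f -> epi f -> is_iso f.
Proof.
move=> mf ef; have [Q [q [kf cq]]] := mono_short_exact mf.
have q0 : q = 0 by apply: ef; rewrite kf.1 comp0m.
have [g fg] : exists g, f \oc g = idm Y.
  by apply: (kernel_lift kf); rewrite compm1.
exists g; split=> //.
by apply: mf; rewrite compA fg comp1m compm1.
Qed.

(** The image is the kernel m of the cokernel c of f.  If u kills the
    corestriction e of f, then m o ker u is a subobject through which f factors,
    so its cokernel kills f and hence m; thus ker u is everything and u = 0. *)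
Lemma image_factor X Y (f : mor X Y) :
  exists (I : C) (e : mor X I) (m : mor I Y), [/\ epi e, mono m & f = m \oc e].
Proof.
have [Q [c cc]] := ab_cokernel abC f; have [I [m km]] := ab_kernel abC c.
have [e me] := kernel_lift km cc.1.
exists I, e, m; split=> //; last exact: kernel_mono km.
have mm := kernel_mono km.
apply/epiP => Z u ue; have [K [k kk]] := ab_kernel abC u.
have [e' ke] := kernel_lift kk ue.
have mmk : mono (m \oc k) by apply: mono_comp => //; exact: kernel_mono kk.
have [D [d [kd cd]]] := mono_short_exact mmk.
have [d' dc] : exists d', d' \oc c = d.
  by apply: (cokernel_lift cc); rewrite -me -ke !compA -(compA d) kd.1 comp0m.
have [s ms] : exists s, (m \oc k) \oc s = m.
  by apply: (kernel_lift kd); rewrite -dc -compA km.1 compm0.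
have ks : k \oc s = idm I by apply: mm; rewrite compA ms compm1.
by rewrite -(compm1 u) -ks compA kk.1 comp0m.
Qed.

(** The pullback is the kernel of f pX - g pY on the biproduct.  That epis are
    stable under pullback is the point where normality of epis enters: this
    difference h is then an epi, hence the cokernel of the pullback, so a map u
    out of Y killing the pullback satisfies u pY = v h for some v; restricting to
    X gives v f = 0, hence v = 0 and u = 0. *)
Lemma pullback_exists X Y Z (f : mor X Z) (g : mor Y Z) :
  exists (P : C) (p : mor P X) (q : mor P Y),
    [/\ f \oc p = g \oc q,
        forall T (u : mor T X) (v : mor T Y), f \oc u = g \oc v ->
          exists2 w : mor T P, p \oc w = u & q \oc w = v,
        mono g -> mono p & epi f -> epi q].
Proof.
have [B [iX [iY [pX [pY [e1 e2 e3 e4 e5]]]]]] := ab_biproduct abC X Y.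
set h : mor B Z := f \oc pX - g \oc pY.
have hX : h \oc iX = f by rewrite compBl -!compA e1 e4 compm1 compm0 subr0.
have hY : h \oc iY = - g by rewrite compBl -!compA e2 e3 compm1 compm0 sub0r.
have [P [k kk]] := ab_kernel abC h.
have comm : f \oc (pX \oc k) = g \oc (pY \oc k).
  by apply/subr0_eq; rewrite !compA -compBl -/h kk.1.
have univ T (u : mor T X) (v : mor T Y) : f \oc u = g \oc v ->
    exists2 w : mor T P, (pX \oc k) \oc w = u & (pY \oc k) \oc w = v.
  move=> fu; have [w kw] : exists w, k \oc w = iX \oc u + iY \oc v.
    apply: (kernel_lift kk).
    by rewrite compDr !compA hX hY compNm fu subrr.
  exists w; rewrite -compA kw compDr !compA.
    by rewrite e1 e3 comp1m comp0m addr0.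
  by rewrite e2 e4 comp1m comp0m add0r.
exists P, (pX \oc k), (pY \oc k); split=> //.
  move=> mg; apply/monoP => T u pu.
  have qu : (pY \oc k) \oc u = 0.
    by apply: mg; rewrite compm0 compA -comm -compA pu compm0.
  apply: (kernel_mono kk); rewrite compm0 -(comp1m (k \oc u)) -e5 compDl.
  by rewrite -!compA (compA pX) (compA pY) pu qu !compm0 addr0.
move=> ef; have eh : epi h by apply: (@epi_cancel _ _ _ _ _ iX); rewrite hX.
have ch := epi_is_cokernel eh kk.
apply/epiP => T u uq.
have [v vh] : exists v, v \oc h = u \oc pY.
  by apply: (cokernel_lift ch); rewrite -compA.
have v0 : v = 0.
  by apply: ef; rewrite comp0m -hX compA vh -compA e4 compm0.
by rewrite -(compm1 u) -e2 compA -vh v0 !comp0m.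
Qed.

(** Preimage of a subobject Z' of the quotient Z = Y / X: again an extension of
    Z' by X. *)
Lemma short_exact_preimage X Y Z Z' (f : mor X Y) (g : mor Y Z) (m : mor Z' Z) :
  short_exact f g -> mono m ->
  exists (Y' : C) (m' : mor Y' Y) (g' : mor Y' Z') (f' : mor X Y'),
    [/\ mono m', g \oc m' = m \oc g', m' \oc f' = f, short_exact f' g'
      & forall T (u : mor T Y) (v : mor T Z'), g \oc u = m \oc v ->
          exists2 w, m' \oc w = u & g' \oc w = v].
Proof.
move=> [kf cg] mm.
have [P [p [q [comm univ mp eq]]]] := pullback_exists g m.
have [f' pf qf] : exists2 f', p \oc f' = f & q \oc f' = 0.
  by apply: univ; rewrite kf.1 compm0.
exists P, p, q, f'; split=> //; first exact: mp.
apply: epi_kernel_exact; first exact: eq (cokernel_epi cg).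
apply: kernelI => //.
  by apply: (@mono_cancel _ _ _ _ p); rewrite pf; exact: kernel_mono kf.
move=> T u qu; have [v fv] : exists v, f \oc v = p \oc u.
  by apply: (kernel_lift kf); rewrite compA comm -compA qu compm0.
by exists v; apply: (mp mm); rewrite compA pf.
Qed.

Lemma simple_morphism X T (f : mor X T) : simple_ob T -> f = 0 \/ epi f.
Proof.
move=> [nz h]; have [I [e [m [ee mm ->]]]] := image_factor f.
have [zI|im] := h I m mm.
  by left; have [_ z] := zI T; rewrite (z m) comp0m.
by right; apply: epi_comp => //; exact: iso_epi.
Qed.

Lemma simple_epi_iso X T (f : mor X T) : simple_ob X -> epi f -> ~ is_zero T ->
  is_iso f.
Proof.
move=> [_ h] ef nz; have [K [k [kk cf]]] := epi_short_exact ef.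
apply: mono_epi_iso => //; apply/monoP => Z u fu.
have [v <-] := kernel_lift kk fu.
have [zK|ik] := h K k (kernel_mono kk).
  by have [_ z] := zK X; rewrite (z k) comp0m.
case: nz; apply/is_zeroP; apply: ef; apply: (iso_epi ik).
by rewrite comp1m kk.1 !comp0m.
Qed.

Definition iso_invariant (V : Type) (c : C -> V) :=
  forall X Y, isomorphic X Y -> c X = c Y.

(** The universal such function is the class in K_0; the forms on K_0, the
    length and the dimension vector are the ones of interest. *)
Definition additive_ob (V : zmodType) (d : C -> V) :=
  forall X Y Z (f : mor X Y) (g : mor Y Z), short_exact f g -> d Y = d X + d Z.

Section AdditiveFunction.
Variables (V : zmodType) (d : C -> V) (add_d : additive_ob d).

Lemma zero_short_exact X Y (f : mor X X) : is_zero Y -> is_iso f ->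
  short_exact f (0 : mor X Y).
Proof.
move=> zY iF; apply: mono_cokernel_exact; first exact: iso_mono.
apply: cokernelI; rewrite ?comp0m//.
  by apply/epiP => T u _; have [_ z] := zY T; exact: z.
by move=> T u uf; exists 0; rewrite comp0m; apply: (iso_epi iF); rewrite uf comp0m.
Qed.

Lemma additive_ob0 X : is_zero X -> d X = 0.
Proof.
move=> zX; have /add_d : short_exact (idm X) (0 : mor X X).
  by apply: zero_short_exact => //; exists (idm X); rewrite comp1m.
by move=> e; apply: (addIr (d X)); rewrite add0r -e.
Qed.

Lemma additive_ob_iso : iso_invariant d.
Proof.
move=> X Y [f iF]; have [Q [q se]] := mono_short_exact (iso_mono iF).
have zQ : is_zero Q.
  apply/is_zeroP; apply: (cokernel_epi se.2); rewrite comp0m comp1m.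
  by apply: (iso_epi iF); rewrite se.1.1 comp0m.
by rewrite (add_d se) (additive_ob0 zQ) addr0.
Qed.

Lemma additive_ob_biproduct X Y P (iX : mor X P) (iY : mor Y P) (pX : mor P X)
  (pY : mor P Y) : is_biproduct iX iY pX pY -> d P = d X + d Y.
Proof.
move=> [e1 e2 e3 e4 e5]; apply: (@add_d X P Y iX pY).
have mi : mono iX by apply: (@mono_cancel _ _ _ _ pX); rewrite e1; exact: idm_mono.
have ep : epi pY by apply: (@epi_cancel _ _ _ _ _ iY); rewrite e2; exact: idm_epi.
apply: epi_kernel_exact => //; apply: kernelI => // T u pu.
by exists (pX \oc u); rewrite -[RHS]comp1m -e5 compDl -!compA pu compm0 addr0.
Qed.

Lemma additive_ob_coimage X Y (f : mor X Y) (K : C) (k : mor K X) :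
  is_kernel k f -> exists I (e : mor X I) (m : mor I Y),
  [/\ epi e, mono m, f = m \oc e, short_exact k e & d X = d K + d I].
Proof.
move=> kk; have [I [e [m [ee mm fE]]]] := image_factor f.
have ke : short_exact k e.
  apply: epi_kernel_exact => //; apply: kernelI; first exact: kernel_mono kk.
    by apply: mm; rewrite compm0 compA -fE kk.1.
  by move=> T u eu; apply: (kernel_lift kk); rewrite fE -compA eu compm0.
by exists I, e, m; split=> //; exact: add_d ke.
Qed.

End AdditiveFunction.

(** I and J are the kernel and the image of the map from the biproduct of U and W
    to M, so the identity is additivity along a single short exact sequence. *)
Lemma modular_law M (U W : subobject M) : exists I J : subobject M,
  [/\ sub_le I U, sub_le I W, sub_le U J, sub_le W J
    & forall (V : zmodType) (d : C -> V), additive_ob d ->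
        d (sub_ob I) + d (sub_ob J) = d (sub_ob U) + d (sub_ob W)].
Proof.
have [B [iX [iY [pX [pY bip]]]]] := ab_biproduct abC (sub_ob U) (sub_ob W).
have [e1 e2 e3 e4 e5] := bip.
set h : mor B M := sub_mor U \oc pX + sub_mor W \oc pY.
have hX : h \oc iX = sub_mor U by rewrite compDl -!compA e1 e4 compm1 compm0 addr0.
have hY : h \oc iY = sub_mor W by rewrite compDl -!compA e2 e3 compm1 compm0 add0r.
have [K [k kk]] := ab_kernel abC h.
have [J [e [m [ee mm hE]]]] := image_factor h.
have kE : sub_mor U \oc (pX \oc k) = sub_mor W \oc (- (pY \oc k)).
  apply/subr0_eq; rewrite compmN opprK !compA -compDl -/h.
  exact: kk.1.
have mI : mono (sub_mor U \oc (pX \oc k)).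
  apply/monoP => T u hu.
  have pXu : pX \oc (k \oc u) = 0.
    by apply: (@sub_mono _ _ U); rewrite compm0 -hu -!compA.
  have pYu : pY \oc (k \oc u) = 0.
    apply: oppr_inj; apply: (@sub_mono _ _ W).
    by rewrite oppr0 compm0 -hu kE -compA compNm -compA.
  by apply: (kernel_mono kk); rewrite compm0 -[LHS]comp1m -e5 compDl -!compA
    pXu pYu !compm0 addr0.
exists (Subobject mI), (Subobject mm); split.
- by exists (pX \oc k).
- by exists (- (pY \oc k)); rewrite /= -kE.
- by exists (e \oc iX); rewrite /= compA -hE.
- by exists (e \oc iY); rewrite /= compA -hE.
move=> V d dA /=; rewrite -(additive_ob_biproduct dA bip).
have [I [e' [m' [ee' mm' hE' _ ->]]]] := additive_ob_coimage dA kk.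
congr (_ + _); apply: (additive_ob_iso dA).
have se := ab_epi_normal abC ee.
have [T [g cg]] := se.
have [v ve] : exists v, v \oc e = e'.
  by apply: (cokernel_lift cg); apply: mm'; rewrite compm0 compA -hE' hE -compA cg.1 compm0.
exists v; apply: mono_epi_iso.
  apply: (@mono_cancel _ _ _ _ m').
  suff -> : m' \oc v = m by [].
  by apply: ee; rewrite -compA ve -hE' hE.
by apply: (@epi_cancel _ _ _ _ _ e); rewrite ve.
Qed.

End Abelian.

(** * The Jordan-Hoelder theorem and dimension vectors *)

Section JordanHolder.
Variables (C : preadd_cat) (abC : abelian C).
Implicit Types X Y Z T : C.

Lemma comp_series_inv X s : comp_series X s ->
  (is_zero X /\ s = [::]) \/
  exists (X' T : C) (f : mor X' X) (g : mor X T) s',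
    [/\ short_exact f g, simple_ob T, comp_series X' s' & s = rcons s' T].
Proof.
case=> {X s} [X zX|X Y T f g s se sT cs]; [by left|right].
by exists X, T, f, g, s.
Qed.

(** Pull the composition series of Z back along Y -> Z, one step at a time. *)
Lemma comp_series_cat X Y Z (f : mor X Y) (g : mor Y Z) sX sZ :
  short_exact f g -> comp_series X sX -> comp_series Z sZ ->
  comp_series Y (sX ++ sZ).
Proof.
move=> se csX csZ; elim: csZ Y f g se => {Z sZ}.
  move=> Z zZ Y f g [kf cg]; rewrite cats0; apply: comp_series_iso csX.
  exists f; apply: (mono_epi_iso abC (kernel_mono kf)); apply/epiP => T u uf.
  have [v <-] := cokernel_lift cg uf.
  by have [_ z] := zZ T; rewrite (z v) comp0m.
move=> Z' Z T i t s [ki ct] sT _ IH Y f g se.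
have mi := kernel_mono ki.
have [Y' [m' [g' [f' [mm' gm _ se' univ]]]]] := short_exact_preimage abC se mi.
rewrite -rcons_cat; apply: (@comp_series_ext _ Y' Y T m' (t \oc g)) => //; last exact: IH se'.
apply: (epi_kernel_exact abC).
  by apply: epi_comp; [exact: cokernel_epi ct|exact: cokernel_epi se.2].
apply: kernelI => //; first by rewrite -compA gm compA ki.1 comp0m.
move=> U u tgu; have [v iv] : exists v, i \oc v = g \oc u.
  by apply: (kernel_lift ki); rewrite compA.
by have [w mw _] := univ _ u v (esym iv); exists w.
Qed.

(** The step of the Jordan-Hoelder theorem.  By Schur's lemma g2 f1 and g1 f2 are
    zero or epi.  If one vanishes, X1 and X2 are the same subobject; otherwise the
    intersection K of X1 and X2 has quotients T2 in X1 and T1 in X2. *)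
Lemma two_maximal_subobjects X X1 X2 T1 T2 (f1 : mor X1 X) (g1 : mor X T1)
    (f2 : mor X2 X) (g2 : mor X T2) :
  short_exact f1 g1 -> short_exact f2 g2 -> simple_ob T1 -> simple_ob T2 ->
  (isomorphic X1 X2 /\ isomorphic T1 T2) \/
  exists (K : C) (k1 : mor K X1) (k2 : mor K X2),
    short_exact k1 (g2 \oc f1) /\ short_exact k2 (g1 \oc f2).
Proof.
move=> [kf1 cg1] [kf2 cg2] s1 s2.
have [e0|e1] := simple_morphism abC (g2 \oc f1) s2.
  left; have [a ag1] := cokernel_lift cg1 e0.
  have ia : is_iso a.
    apply: (simple_epi_iso abC) => //; last exact: s2.1.
    by apply: (@epi_cancel _ _ _ _ _ g1); rewrite ag1; exact: cokernel_epi cg2.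
  split; last by exists a.
  have kf2' : is_kernel f2 g1.
    apply: kernelI; first exact: kernel_mono kf2.
      by apply: (iso_mono ia); rewrite compA ag1 kf2.1 compm0.
    by move=> Z u gu; apply: (kernel_lift kf2); rewrite -ag1 -compA gu compm0.
  by have [h ih _] := kernel_isomorphic kf2' kf1; exists h.
have [e0|e2] := simple_morphism abC (g1 \oc f2) s1.
  have [b bg2] := cokernel_lift cg2 e0.
  have ib : is_iso b.
    apply: (simple_epi_iso abC) => //; last exact: s1.1.
    by apply: (@epi_cancel _ _ _ _ _ g2); rewrite bg2; exact: cokernel_epi cg1.
  have g2f10 : g2 \oc f1 = 0.
    by apply: (iso_mono ib); rewrite compA bg2 kf1.1 compm0.
  case: s2 => -[]; apply/is_zeroP; apply: e1.
  by rewrite g2f10 !compm0.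
right; have [K [k1 kk]] := ab_kernel abC (g2 \oc f1).
have [k2 fk] : exists k2, f2 \oc k2 = f1 \oc k1.
  by apply: (kernel_lift kf2); rewrite compA kk.1.
exists K, k1, k2; split; first exact: epi_kernel_exact.
apply: epi_kernel_exact => //; apply: kernelI.
- apply: (@mono_cancel _ _ _ _ f2); rewrite fk; apply: mono_comp.
    exact: kernel_mono kf1.
  exact: kernel_mono kk.
- by rewrite -compA fk compA kf1.1 comp0m.
- move=> Z u gfu; have [v fv] : exists v, f1 \oc v = f2 \oc u.
    by apply: (kernel_lift kf1); rewrite compA.
  have [w kw] : exists w, k1 \oc w = v.
    by apply: (kernel_lift kk); rewrite -compA fv compA kf2.1 comp0m.
  by exists w; apply: (kernel_mono kf2); rewrite compA fk -compA kw.
Qed.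

Hypothesis flC : finite_length C.

(** Comparing sums of an arbitrary isomorphism invariant c over the factors, with
    values in any abelian group, amounts to comparing the factors with their
    multiplicities, and avoids permutations up to isomorphism. *)
Theorem jordan_holder (V : zmodType) (c : C -> V) X s s' : iso_invariant c ->
  comp_series X s -> comp_series X s' ->
  size s = size s' /\ \sum_(T <- s) c T = \sum_(T <- s') c T.
Proof.
move=> cI; have [N] := ubnP (size s); elim: N X s s' => // N IH X s s' sN cs cs'.
have nonzero Y Y' T (f : mor Y' Y) (g : mor Y T) : short_exact f g ->
    simple_ob T -> ~ is_zero Y.
  by move=> [_ cg] [nT _] zY; apply: nT; apply: epi_is_zero zY; exact: cokernel_epi cg.
have [[zX ->]|[X1 [T1 [f1 [g1 [s1 [se1 sT1 cs1 sE]]]]]]] := comp_series_inv cs.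
  have [[_ ->]//|[X2 [T2 [f2 [g2 [s2 [se2 sT2 _ _]]]]]]] := comp_series_inv cs'.
  by case: (nonzero _ _ _ _ _ se2 sT2 zX).
have [[zX _]|[X2 [T2 [f2 [g2 [s2 [se2 sT2 cs2 s'E]]]]]]] := comp_series_inv cs'.
  by case: (nonzero _ _ _ _ _ se1 sT1 zX).
rewrite sE s'E !size_rcons -!cats1 !big_cat !big_seq1 /=.
have s1N : (size s1 < N)%N by move: sN; rewrite sE size_rcons ltnS.
have [[iX iT]|[K [k1 [k2 [e1 e2]]]]] := two_maximal_subobjects se1 se2 sT1 sT2.
  have [-> ->] := IH _ _ _ s1N cs1 (comp_series_iso (isomorphic_sym iX) cs2).
  by rewrite (cI _ _ iT).
have [k ck] := flC K.
have [z1 d1] := IH _ _ _ s1N cs1 (comp_series_ext e1 sT2 ck).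
have c2 := comp_series_ext e2 sT1 ck.
have s2N : (size (rcons k T1) < N)%N.
  by rewrite size_rcons -(size_rcons k T2) -z1.
have [z2 d2] := IH _ _ _ s2N c2 cs2.
rewrite z1 -z2 !size_rcons d1 -d2 -!cats1 !big_cat !big_seq1 /=.
by rewrite -!addrA [c T1 + _]addrC.
Qed.

Definition series_of X : seq C := projT1 (cid (flC X)).

Lemma series_ofP X : comp_series X (series_of X).
Proof. by rewrite /series_of; case: cid. Qed.

Definition length_sum (V : zmodType) (c : C -> V) X : V :=
  \sum_(T <- series_of X) c T.

Lemma length_sumE (V : zmodType) (c : C -> V) X s : iso_invariant c ->
  comp_series X s -> length_sum c X = \sum_(T <- s) c T.
Proof. by move=> cI cs; have [] := jordan_holder cI (series_ofP X) cs. Qed.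

Lemma length_sum_additive (V : zmodType) (c : C -> V) : iso_invariant c ->
  additive_ob (length_sum c).
Proof.
move=> cI X Y Z f g se; rewrite -big_cat; apply: length_sumE => //.
by apply: comp_series_cat se _ _; exact: series_ofP.
Qed.

Lemma simple_comp_series T : simple_ob T -> comp_series T [:: T].
Proof.
move=> sT; have [Z zZ] := ab_zero abC.
apply: (@comp_series_ext _ Z T T 0 (idm T) [::]) => //; last exact: comp_series_zero.
apply: epi_kernel_exact => //; first exact: idm_epi.
apply: kernelI; rewrite ?compm0//.
  by apply/monoP => U u _; have [z _] := zZ U; exact: z.
by move=> U u; rewrite comp1m => ->; exists 0; rewrite compm0.
Qed.

Lemma length_sum_simple (V : zmodType) (c : C -> V) T : iso_invariant c ->
  simple_ob T -> length_sum c T = c T.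
Proof.
by move=> cI /simple_comp_series cs; rewrite (length_sumE cI cs) big_seq1.
Qed.

Lemma additive_ob_eq (V : zmodType) (d d' : C -> V) :
  additive_ob d -> additive_ob d' ->
  (forall T, simple_ob T -> d T = d' T) -> d =1 d'.
Proof.
move=> dA d'A e X; have [s cs] := flC X.
elim: cs => {X s} [X zX|X Y T f g s se sT _ IH].
  by rewrite !additive_ob0.
by rewrite (dA _ _ _ _ _ se) (d'A _ _ _ _ _ se) IH e.
Qed.

Definition ob_length X : int := length_sum (fun=> 1) X.

Lemma ob_length_additive : additive_ob ob_length.
Proof. exact: length_sum_additive. Qed.

Lemma ob_lengthE X : ob_length X = (size (series_of X))%:Z.
Proof. by rewrite /ob_length /length_sum big_const_seq count_predT iter_addr_0 natz. Qed.

Lemma ob_length_eq0 X : ob_length X = 0 -> is_zero X.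
Proof.
rewrite ob_lengthE => -[/size0nil s0]; have := series_ofP X; rewrite s0.
move=> /comp_series_inv[[]//|[X' [T [f [g [s' [_ _ _]]]]]]].
by case: s'.
Qed.

Lemma mono_ob_length X Y (f : mor X Y) : mono f -> ob_length X <= ob_length Y.
Proof.
move=> /(mono_short_exact abC)[Q [q /ob_length_additive ->]].
by rewrite lerDl ob_lengthE.
Qed.

Lemma mono_ob_length_iso X Y (f : mor X Y) : mono f ->
  ob_length Y <= ob_length X -> is_iso f.
Proof.
move=> mf; have [Q [q se]] := mono_short_exact abC mf.
rewrite (ob_length_additive se) gerDl ob_lengthE => h.
have zQ : is_zero Q by apply: ob_length_eq0; apply/eqP; rewrite ob_lengthE eq_le h.
apply: (mono_epi_iso abC mf); apply/epiP => Z u uf.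
have [v <-] := cokernel_lift se.2 uf.
by have [_ z] := zQ Z; rewrite (z v) comp0m.
Qed.

Section Dimension.
Variables (n : nat) (S : 'I_n -> C) (simS : simple_reps S).

(** The indicator vector of the isoclass of T; it is only meaningful, and then a
    unit vector, when T is simple. *)
Definition simple_vec T : 'rV[int]_n :=
  \row_i (if `[< isomorphic T (S i) >] then 1 else 0).

Lemma simple_vec_iso : iso_invariant simple_vec.
Proof.
move=> X Y iXY; apply/rowP => i; rewrite !mxE; congr (if _ then _ else _).
apply/asbool_equiv_eq; split; last exact: isomorphic_trans.
exact/isomorphic_trans/isomorphic_sym.
Qed.

Definition dimvec X : 'rV[int]_n := length_sum simple_vec X.

Lemma dimvec_additive : additive_ob dimvec.
Proof. exact: length_sum_additive simple_vec_iso. Qed.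

Lemma dimvec_simple i : dimvec (S i) = delta_mx 0 i.
Proof.
have [sS inj _] := simS; rewrite /dimvec length_sum_simple//; last exact: simple_vec_iso.
apply/rowP => j; rewrite !mxE eqxx /= eq_sym; case: asboolP => [/inj ->|h].
  by rewrite eqxx.
case: eqP => // ij; case: h; rewrite ij; exact: isomorphic_refl.
Qed.

Lemma dimvec_ge0 X i : 0 <= dimvec X 0 i.
Proof.
rewrite /dimvec /length_sum summxE; apply: sumr_ge0 => T _.
by rewrite mxE; case: ifP.
Qed.

Lemma dimvec_mono X Y (f : mor X Y) i : mono f -> dimvec X 0 i <= dimvec Y 0 i.
Proof.
move=> /(mono_short_exact abC)[Q [q /dimvec_additive ->]].
by rewrite mxE lerDl dimvec_ge0.
Qed.

Lemma additive_ob_dimvec (V : zmodType) (d : C -> V) : additive_ob d ->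
  forall X, d X = \sum_i d (S i) *~ dimvec X 0 i.
Proof.
move=> dA; apply: additive_ob_eq => //.
  move=> X Y Z f g /dimvec_additive ->; rewrite -big_split.
  by apply: eq_bigr => i _; rewrite mxE mulrzDr.
move=> T sT; have [_ _ /(_ _ sT)[i iT]] := simS.
rewrite (additive_ob_iso abC dA iT) (additive_ob_iso abC dimvec_additive iT).
rewrite dimvec_simple (bigD1 i)//= mxE !eqxx big1 ?addr0// => j ji.
by rewrite mxE (negPf ji) andbF.
Qed.

End Dimension.

End JordanHolder.

(** * Forms on the Grothendieck group *)

Section GrothendieckGroup.
Variable C : preadd_cat.

Lemma K0_class_exact (X Y Z : C) (f : mor X Y) (g : mor Y Z) :
  short_exact f g -> K0_class Y = K0_class X + K0_class Z.
Proof.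
move=> se; apply/eqP; rewrite -subr_eq0 opprD addrA; apply/eqP.
rewrite /K0_class -!raddfB -[RHS](raddf0 (\pi_(Quotient.quot (@K0_span C)))%qT); apply/eqP.
rewrite -Quotient.idealrBE subr0; apply/asboolP => H _; apply.
by exists X, Y, Z, f, g.
Qed.

Variable R : realType.

Lemma pairing_additive (theta : K0_dual C R) : additive_ob (pairing theta).
Proof.
by move=> X Y Z f g /K0_class_exact e; rewrite /pairing e raddfD.
Qed.

Section Lift.
Variables (d : C -> R) (dA : additive_ob d).

Let lift_free (D : {freeg {classic C}}) : R := fglift (d : {classic C} -> zmodule R) D.

Let lift_freeB D D' : lift_free (D - D') = lift_free D - lift_free D'.
Proof. exact: (@lift_is_additive int {classic C} (zmodule R) d D D'). Qed.

Let lift_free_span D : K0_span D -> lift_free D = 0.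
Proof.
move=> /asboolP /(_ (fun x => lift_free x == 0)) h; apply/eqP; apply: h.
  split; first by rewrite unfold_in -(subrr 0) lift_freeB subrr.
  by move=> x y; rewrite !unfold_in lift_freeB => /eqP -> /eqP ->; rewrite subrr.
move=> _ [X [Y [Z [f [g [se ->]]]]]]; rewrite unfold_in !lift_freeB /lift_free !liftU.
by rewrite !scale1r (dA se) addrAC addrK subrr.
Qed.

Let lift_K0 (a : K0 C) : R := lift_free (repr a).

Let lift_K0_pi D : lift_K0 (\pi_(Quotient.quot (@K0_span C)) D)%qT = lift_free D.
Proof.
apply/eqP; rewrite -subr_eq0 -lift_freeB; apply/eqP/lift_free_span.
rewrite [K0_span _]Quotient.idealrBE; apply/eqP.
by rewrite reprK.
Qed.

Let lift_K0_additive : additive lift_K0.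
Proof.
by elim/quotW => x; elim/quotW => y; rewrite -raddfB !lift_K0_pi lift_freeB.
Qed.

HB.instance Definition _ := GRing.isZmodMorphism.Build (K0 C) R lift_K0 lift_K0_additive.

(** Universal property of K_0: the linear extension of d to the free group kills
    the relations exactly because d is additive. *)
Lemma K0_dual_lift : exists theta : K0_dual C R, forall X, pairing theta X = d X.
Proof.
exists (lift_K0 : {additive K0 C -> R}) => X.
by rewrite /pairing /K0_class /= lift_K0_pi /lift_free liftU scale1r.
Qed.

End Lift.
End GrothendieckGroup.

(** * Subobjects and subquotients *)

Section Subobjects.
Variables (C : preadd_cat) (abC : abelian C).
Variable M : C.
Implicit Types (U W L : subobject M).

Lemma sub_le_trans U W L : sub_le U W -> sub_le W L -> sub_le U L.
Proof. by move=> [h e] [k e']; exists (k \oc h); rewrite compA e' e. Qed.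

Lemma sub_le_mono U W (h : mor (sub_ob U) (sub_ob W)) :
  sub_mor W \oc h = sub_mor U -> mono h.
Proof. by move=> e; apply: (@mono_cancel _ _ _ _ (sub_mor W)); rewrite e; exact: sub_mono. Qed.

Lemma sub_iso_le U W (h : mor (sub_ob U) (sub_ob W)) :
  sub_mor W \oc h = sub_mor U -> is_iso h -> sub_le W U.
Proof.
by move=> e [k [kh hk]]; exists k; rewrite -e -compA hk compm1.
Qed.

Lemma sub_eq_iso U W : sub_eq U W -> isomorphic (sub_ob U) (sub_ob W).
Proof.
move=> [[h e] [k e']]; exists h, k; split.
  by apply: (@sub_mono _ _ U); rewrite compA e' e compm1.
by apply: (@sub_mono _ _ W); rewrite compA e e' compm1.
Qed.

Section Quotient.
Variables (U W : subobject M) (Q : C) (h : mor (sub_ob U) (sub_ob W))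
  (q : mor (sub_ob W) Q).
Hypotheses (hE : sub_mor W \oc h = sub_mor U) (cq : is_cokernel q h).

Lemma sub_quotient_exact : short_exact h q.
Proof. by apply: mono_cokernel_exact => //; exact: sub_le_mono hE. Qed.

Lemma sub_of_quotient X (m : mor X Q) : mono m ->
  exists L, [/\ sub_le U L, sub_le L W &
    forall (V : zmodType) (d : C -> V), additive_ob d ->
      d (sub_ob L) = d (sub_ob U) + d X].
Proof.
move=> mm; have [Y [m' [g' [f' [mm' _ mf se _]]]]] :=
  short_exact_preimage abC sub_quotient_exact mm.
exists (Subobject (mono_comp (@sub_mono _ _ W) mm')); split => /=.
- by exists f'; rewrite /= -compA mf.
- by exists m'.
- by move=> V d dA; exact: dA se.
Qed.

Lemma quotient_of_sub L : sub_le U L -> sub_le L W ->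
  exists (X : C) (m : mor X Q), mono m /\
    forall (V : zmodType) (d : C -> V), additive_ob d ->
      d (sub_ob L) = d (sub_ob U) + d X.
Proof.
move=> [u uE] [l lE].
have kk : is_kernel u (q \oc l).
  have lu : l \oc u = h by apply: (@sub_mono _ _ W); rewrite compA lE uE.
  apply: kernelI; first exact: sub_le_mono uE.
    by rewrite -compA lu cq.1.
  move=> T v qv; have [w hw] : exists w, h \oc w = l \oc v.
    by apply: (kernel_lift sub_quotient_exact.1); rewrite compA.
  exists w; apply: (@sub_mono _ _ L).
  by rewrite compA uE -hE -compA hw compA lE.
have [X [e [m [ee mm mE]]]] := image_factor abC (q \oc l).
have se : short_exact u e.
  apply: (epi_kernel_exact abC) => //; apply: kernelI; first exact: kernel_mono kk.
    by apply: mm; rewrite compm0 compA -mE kk.1.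
  by move=> T v eu; apply: (kernel_lift kk); rewrite mE -compA eu compm0.
by exists X, m; split=> // V d dA; exact: dA se.
Qed.

End Quotient.
End Subobjects.

Lemma exists_minimizer (T : Type) (P : T -> Prop) (f : T -> nat) :
  (exists x, P x) -> exists2 x, P x & forall y, P y -> (f x <= f y)%N.
Proof.
move=> [x0 Px0].
have ex : exists k, `[< exists2 x, P x & f x = k >].
  by exists (f x0); apply/asboolP; exists x0.
case: (ex_minnP ex) => k /asboolP[x Px fx] kmin; exists x => // y Py.
by rewrite fx; apply: kmin; apply/asboolP; exists y.
Qed.

(** * Semistable objects and their composition series *)

Section Semistable.
Variables (C : preadd_cat) (abC : abelian C) (R : realType).
Variable theta : K0_dual C R.
Implicit Types X Y Z : C.
Local Notation th := (pairing theta).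
Let thA : additive_ob th := @pairing_additive _ _ theta.

Lemma Wss_pairing X : Wss theta X -> th X = 0.
Proof.
move=> [/(_ _ _ (@idm_epi _ X)) t /(_ _ _ (@idm_mono _ X)) f].
by apply/eqP; rewrite eq_le t f.
Qed.

(** When theta(X) = 0, the conditions on subobjects and on quotients are
    equivalent, since theta(L) + theta(X / L) = 0. *)
Lemma Fbar_Wss X : Fbar theta X -> th X = 0 -> Wss theta X.
Proof.
move=> F X0; split=> // N p ep; have [K [k se]] := epi_short_exact abC ep.
have := F _ _ (kernel_mono se.1).
by have := thA se; rewrite X0 => /esym/eqP; rewrite addr_eq0 => /eqP ->; rewrite oppr_le0.
Qed.

Lemma Tbar_Wss X : Tbar theta X -> th X = 0 -> Wss theta X.
Proof.
move=> F X0; split=> // N p ep; have [K [k se]] := mono_short_exact abC ep.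
have := F _ _ (cokernel_epi se.2).
have := thA se; rewrite X0 addrC => /esym/eqP.
by rewrite addr_eq0 => /eqP ->; rewrite oppr_ge0.
Qed.

Lemma Wss_sub X Y (m : mor X Y) : mono m -> Wss theta Y -> th X = 0 -> Wss theta X.
Proof.
move=> mm [_ F]; apply: Fbar_Wss => L i mi; exact: F (mono_comp mm mi).
Qed.

Lemma Wss_quotient X Y (e : mor X Y) : epi e -> Wss theta X -> th Y = 0 -> Wss theta Y.
Proof.
move=> ee [T _]; apply: Tbar_Wss => L i mi; exact: T (epi_comp mi ee).
Qed.

Lemma Wss_iso X Y : isomorphic X Y -> Wss theta X -> Wss theta Y.
Proof.
move=> iXY WX; have e := additive_ob_iso abC thA iXY.
have [f iF] := iXY; apply: (Wss_quotient (iso_epi iF)) => //.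
by rewrite -e; exact: Wss_pairing.
Qed.

Lemma Wss_zero X : is_zero X -> Wss theta X.
Proof.
move=> zX; apply: Fbar_Wss; last exact (additive_ob0 abC thA zX).
by move=> L i mi; rewrite (additive_ob0 abC thA (mono_is_zero mi zX)).
Qed.

(** The image of f is a quotient of X and a subobject of Y, so theta is both
    nonnegative and nonpositive on it. *)
Lemma Wss_kernel X Y K (k : mor K X) (f : mor X Y) :
  Wss theta X -> Wss theta Y -> is_kernel k f -> Wss theta K.
Proof.
move=> WX WY kk; have [I [e [m [ee mm _ _ dE]]]] := additive_ob_coimage abC thA kk.
apply: (Wss_sub (kernel_mono kk)) => //.
have I0 : th I = 0.
  by apply/eqP; rewrite eq_le (WX.1 _ _ ee) (WY.2 _ _ mm).
by have := Wss_pairing WX; rewrite dE I0 addr0.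
Qed.

Lemma Wss_cokernel X Y Q (q : mor Y Q) (f : mor X Y) :
  Wss theta X -> Wss theta Y -> is_cokernel q f -> Wss theta Q.
Proof.
move=> WX WY cq; apply: (Wss_quotient (cokernel_epi cq)) => //.
have [I [e [m [ee mm fE]]]] := image_factor abC f.
have I0 : th I = 0.
  by apply/eqP; rewrite eq_le (WX.1 _ _ ee) (WY.2 _ _ mm).
have cm : is_cokernel q m.
  apply: cokernelI; first exact: cokernel_epi cq.
    by apply: ee; rewrite comp0m -compA -fE cq.1.
  by move=> Z u um; apply: (cokernel_lift cq); rewrite fE compA um comp0m.
have := thA (mono_cokernel_exact abC mm cm).
by rewrite I0 add0r (Wss_pairing WY).
Qed.

Local Notation W := (fullsub (Wss theta)).

Lemma fullsub_is_zero (X : W) : is_zero X <-> is_zero (sval X).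
Proof. by rewrite !is_zeroP. Qed.

(** Not formal: it holds because W_theta is closed under kernels. *)
Lemma fullsub_mono (X Y : W) (f : mor X Y) :
  mono f <-> @mono C (sval X) (sval Y) f.
Proof.
split=> [mf|mf Z u v]; last exact: mf.
have [K [k kk]] := ab_kernel abC (f : @mor C (sval X) (sval Y)).
have WK := Wss_kernel (svalP X) (svalP Y) kk.
have k0 : k = 0.
  apply: (mf (exist _ K WK : W) k 0); rewrite [LHS]kk.1; symmetry.
  exact: (@compm0 C).
by apply/monoP => Z u fu; have [v <-] := kernel_lift kk fu; rewrite k0 comp0m.
Qed.

Lemma fullsub_short_exact (X Y Z : W) (f : mor X Y) (g : mor Y Z) :
  short_exact f g <->
  @short_exact C (sval X) (sval Y) (sval Z) f g.
Proof.
split=> [[kf cg]|[kf cg]]; last first.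
  split; split; try exact: kf.1; try exact: cg.1.
    by move=> T u; exact: kf.2.
  by move=> T u; exact: cg.2.
split.
  have [K [k kk]] := ab_kernel abC (g : @mor C (sval Y) (sval Z)).
  have WK := Wss_kernel (svalP Y) (svalP Z) kk.
  have kk' : @is_kernel W (exist _ K WK : W) Y Z k g.
    by split=> [|T u]; [exact: kk.1|exact: kk.2].
  by have [h ih <-] := kernel_isomorphic kk' kf; exact: iso_kernel kk ih.
have [Q [q cq]] := ab_cokernel abC (f : @mor C (sval X) (sval Y)).
have WQ := Wss_cokernel (svalP X) (svalP Y) cq.
have cq' : @is_cokernel W X Y (exist _ Q WQ : W) q f.
  by split=> [|T u]; [exact: cq.1|exact: cq.2].
by have [h ih <-] := cokernel_isomorphic cq' cg; exact: iso_cokernel cq ih.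
Qed.

Lemma fullsub_series_sum (V : zmodType) (d : C -> V) (X : W) s :
  additive_ob d -> comp_series X s -> d (sval X) = \sum_(T <- s) d (sval T).
Proof.
move=> dA; elim=> {X s} [X zX|X Y T f g s /fullsub_short_exact se _ _ IH].
  by rewrite big_nil (additive_ob0 abC dA)//; exact/fullsub_is_zero.
by rewrite (dA _ _ _ _ _ se) IH -cats1 big_cat big_seq1.
Qed.

Lemma supp_iso X Y : isomorphic X Y -> supp theta X `<=` supp theta Y.
Proof.
move=> iXY T [hT [hX [s [cs iT]]]].
exists hT, (Wss_iso iXY hX), s; split=> //.
apply: comp_series_iso cs; have [f [g gf]] := iXY.
by exists f, g.
Qed.

Hypothesis flC : finite_length C.
Local Notation obsize X := (size (series_of flC X)).

Lemma mono_obsize X Y (f : mor X Y) : mono f -> (obsize X <= obsize Y)%N.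
Proof. by move=> /(mono_ob_length abC flC); rewrite !ob_lengthE lez_nat. Qed.

Lemma mono_obsize_iso X Y (f : mor X Y) : mono f -> (obsize Y <= obsize X)%N ->
  is_iso f.
Proof.
move=> mf h; apply: (mono_ob_length_iso abC (flC := flC) mf).
by rewrite !ob_lengthE lez_nat.
Qed.

(** A subobject of w in W_theta, minimal among those strictly containing X, has a
    W_theta-simple quotient by X; iterate until w is reached. *)
Lemma comp_series_extend (w X : W) (m : mor X w) s : mono m -> comp_series X s ->
  exists s', comp_series w (s ++ s').
Proof.
have [N] := ubnP (obsize (sval w) - obsize (sval X)).
elim: N X m s => // N IH X m s Nb mm cs.
have mm' : @mono C (sval X) (sval w) m by apply/fullsub_mono.
have [im|nim] := pselect (@is_iso C (sval X) (sval w) m).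
  exists [::]; rewrite cats0; apply: comp_series_iso cs.
  by have [g gm] := im; exists m, g.
(* [P Y]: the object Y lies strictly above X, as subobjects of w. *)
pose P (Y : W) := exists (f : mor X Y) (g : mor Y w),
  [/\ mono f, mono g, g \oc f = m & ~ is_iso f].
have [|Y [f [g [/fullsub_mono mf /fullsub_mono mg gf nif]]] Ymin] :=
  @exists_minimizer _ P (fun Y : W => obsize (sval Y)).
  exists w, m, (idm w); split=> //; [exact: idm_mono|by rewrite comp1m].
have [T [q se]] := mono_short_exact abC mf.
have WT : Wss theta T := Wss_cokernel (svalP X) (svalP Y) se.2.
have sT : @simple_ob W (exist _ T WT).
  split=> [/fullsub_is_zero /= zT|[L WL] i /fullsub_mono/= mi].
    apply: nif; apply: (mono_epi_iso abC mf).
    apply/epiP => Z u uf; have [v <-] := cokernel_lift se.2 uf.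
    by have [_ z] := zT Z; rewrite (z v) comp0m.
  have [Y' [m' [g' [f' [mm2 comm mf' se' _]]]]] := short_exact_preimage abC se mi.
  have WY' : Wss theta Y'.
    apply: (Wss_sub mm2 (svalP Y)).
    by rewrite (thA se') (Wss_pairing (svalP X)) (Wss_pairing WL) addr0.
  have [[k [kf fk]]|nf'] := pselect (is_iso f').
    left; apply/fullsub_is_zero/is_zeroP; apply: (cokernel_epi se'.2).
    rewrite comp0m comp1m -(compm1 g') -fk compA se'.1.1.
    by rewrite comp0m.
  right; suff : is_iso (i : @mor C L T) by [].
  have im' : is_iso m'.
    apply: mono_obsize_iso => //; apply: (Ymin (exist _ Y' WY' : W)).
    exists f', (@compm C Y' (sval Y) (sval w) g m'); split=> //.
    - by apply/fullsub_mono; exact: kernel_mono se'.1.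
    - by apply/fullsub_mono; exact: (mono_comp mg mm2).
    - by rewrite -gf -mf'; symmetry; exact: (@Defs.compA C).
  apply: mono_epi_iso => //; apply: (@epi_cancel _ _ _ _ _ g').
  by rewrite -comm; apply: epi_comp (iso_epi im'); exact: cokernel_epi se.2.
have seW : @short_exact W X Y (exist _ T WT) f q by apply/fullsub_short_exact.
have cY := comp_series_ext seW sT cs.
have [|s' cs'] := IH Y g (rcons s (exist _ T WT)) _ (iffRL (fullsub_mono g) mg) cY.
  have lt : (obsize (sval X) < obsize (sval Y))%N.
    by rewrite ltnNge; apply/negP => /(mono_obsize_iso mf).
  have le := mono_obsize mg; move: Nb; rewrite !ltnS => Nb.
  by rewrite (leq_trans _ Nb)// ltn_sub2l// (leq_trans lt).
by exists (exist _ T WT :: s'); rewrite -cat_rcons.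
Qed.

Lemma fullsub_series (X : W) : exists s, comp_series X s.
Proof.
have [Z zZ] := ab_zero abC; have WZ := Wss_zero zZ.
have cZ : @comp_series W (exist _ Z WZ) [::] by apply: comp_series_zero; exact/fullsub_is_zero.
have m0 : @mono W (exist _ Z WZ) X 0.
  by apply/monoP => T u _; have [z _] := iffRL (fullsub_is_zero (exist _ Z WZ)) zZ T; exact: z.
by have [s' cs'] := comp_series_extend m0 cZ; exists s'.
Qed.

End Semistable.

(** * Comparing the supports of two forms *)

Section CompareSupports.
Variables (C : preadd_cat) (abC : abelian C) (R : realType).
Variables theta eta : K0_dual C R.
Let thA : additive_ob (pairing theta) := @pairing_additive _ _ theta.
Let etaA : additive_ob (pairing eta) := @pairing_additive _ _ eta.

(** On subobjects of w, membership in W_theta and in W_eta is decided by the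
    vanishing of theta and eta.  Hence a composition series of w in W_theta has all
    its terms in W_eta, and its factors remain simple there: a subobject of a
    factor has a preimage in w, to which the hypothesis applies. *)
Lemma supp_transfer w : Wss theta w -> Wss eta w ->
  (forall X (m : mor X w), mono m -> pairing theta X = 0 <-> pairing eta X = 0) ->
  supp theta w `<=` supp eta w.
Proof.
move=> Wtw Wew H T [hT [hw [s [cs iT]]]].
have key (X : fullsub (Wss theta)) s' : comp_series X s' ->
  forall (m : mor (sval X) w) (hX : Wss eta (sval X)), mono m ->
  exists2 t, @comp_series (fullsub (Wss eta)) (exist _ (sval X) hX) t
    & map sval t = map sval s'.
  elim=> {X s'} [X zX m hX mm|X Y U f g s' /(fullsub_short_exact abC) se sU _ IH m hY mm].
    exists [::] => //; apply: comp_series_zero; apply/fullsub_is_zero => /=.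
    exact/fullsub_is_zero.
  have mf := kernel_mono se.1; have mmf := mono_comp mm mf.
  have tX := Wss_pairing (svalP X); have tU := Wss_pairing (svalP U).
  have eX : pairing eta (sval X) = 0 by apply/(H _ _ mmf).
  have hX : Wss eta (sval X) by apply: (Wss_sub abC mf).
  have eU : pairing eta (sval U) = 0.
    by have := etaA se; rewrite (Wss_pairing hY) eX add0r.
  have hU : Wss eta (sval U) by apply: (Wss_quotient abC (cokernel_epi se.2)).
  have [t ct te] := IH _ hX mmf.
  exists (rcons t (exist _ (sval U) hU)); last by rewrite !map_rcons te.
  apply: (@comp_series_ext (fullsub (Wss eta)) (exist _ (sval X) hX)
    (exist _ (sval Y) hY) (exist _ (sval U) hU) f g) => //.
    exact/(fullsub_short_exact abC).
  have [nz simU] := sU; split=> [/fullsub_is_zero/= zU|[L hL] i /(fullsub_mono abC)/= mi].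
    exact/nz/fullsub_is_zero.
  have [Y' [m' [g' [f' [mm' _ _ se' _]]]]] := short_exact_preimage abC se mi.
  have eY' : pairing eta Y' = 0 by rewrite (etaA se') eX (Wss_pairing hL) addr0.
  have tY' : pairing theta Y' = 0 by apply/(H _ _ (mono_comp mm mm')).
  have tL : pairing theta L = 0.
    by have := thA se'; rewrite tX tY' add0r.
  have WL : Wss theta L by apply: (Wss_sub abC mi (svalP U)).
  have [/fullsub_is_zero zL|iL] := simU (exist _ L WL) i
      (iffRL (@fullsub_mono C abC R theta (exist _ L WL) U i) mi).
    by left; apply/fullsub_is_zero.
  by right.
have [t ct te] := key _ _ cs (idm w) Wew (@idm_mono _ w).
have [i iS iso] := iT.
have st : size t = size s by rewrite -(size_map sval) te size_map.
have isoT : isomorphic T (sval (nth (exist _ T hT) s i)).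
  by have [f [g fg]] := iso; exists f, g.
have nthE x : sval (nth x t i) = sval (nth (exist _ T hT) s i).
  by rewrite -(nth_map _ T) ?st// te (nth_map (exist _ T hT)).
have eT : Wss eta T.
  have [x0] : inhabited (fullsub (Wss eta)) by constructor; exists w.
  apply: (Wss_iso abC (X := sval (nth x0 t i))); last exact: svalP.
  by rewrite nthE; exact: isomorphic_sym.
exists eT, Wew, t; split=> //; exists i; rewrite ?st//.
have [f [g fg]] : isomorphic T (sval (nth (exist (Wss eta) T eT) t i)) by rewrite nthE.
by exists f, g.
Qed.

Hypothesis flC : finite_length C.

(** A composition series of X in W_theta is the beginning of one of w, so its
    factors belong to the support of w, hence to W_eta, where eta vanishes. *)
Lemma pairing_of_supp w w' X (m : mor X w) : Wss theta w ->
  supp theta w `<=` supp eta w' -> mono m -> pairing theta X = 0 -> pairing eta X = 0.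
Proof.
move=> Ww sub mm X0; have WX := Wss_sub abC mm Ww X0.
have [s cs] := fullsub_series abC flC (exist (Wss theta) X WX).
have mm' : @mono (fullsub (Wss theta)) (exist _ X WX) (exist _ w Ww) m.
  exact/(fullsub_mono abC).
have [s' cs'] := comp_series_extend abC flC mm' cs.
have /= -> := fullsub_series_sum abC etaA cs.
rewrite (big_nth (exist _ X WX)) big_nat_cond big1// => i /andP[/andP[_ iS] _].
set T := nth _ _ _; have [eT _] : supp eta w' (sval T).
  apply: sub; exists (svalP T), Ww, (s ++ s'); split=> //.
  exists i; first by rewrite size_cat; exact: ltn_addr.
  rewrite nth_cat iS (set_nth_default (exist _ X WX))//.
  have -> : exist _ (sval T) (svalP T) = T by case: (T) => x p; exact: eq_exist.
  exact: isomorphic_refl.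
exact: Wss_pairing eT.
Qed.

End CompareSupports.

(** * Torsion subobjects as extremal maximizers *)

Section Maximizers.
Variables (C : preadd_cat) (abC : abelian C) (flC : finite_length C).
Variables (R : realType) (n : nat) (S : 'I_n -> C) (simS : simple_reps S).
Variable M : C.
Implicit Types (U L W : subobject M).
Local Notation obsize X := (size (series_of flC X)).
Local Notation dim := (dimvec flC S).

(** The dimension vector of a subobject is bounded coordinatewise by that of M. *)
Lemma finite_dimvecs : exists (N : nat) (v : 'I_N.+1 -> 'rV[int]_n),
  (forall L, exists j, dim (sub_ob L) = v j) /\
  (forall j, exists L, dim (sub_ob L) = v j).
Proof.
pose b := \max_(i < n) `|dim M 0%R i|%N.
have fin : finite_set [set dim (sub_ob L) | L in [set: subobject M]].
  apply: (@sub_finite_set _ _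
    [set (\row_i (f i)%:Z : 'rV[int]_n) | f in [set: {ffun 'I_n -> 'I_b.+1}]]); last first.
    exact/finite_image/finite_finset.
  move=> _ [L _ <-].
  have lt i : (`|dim (sub_ob L) 0%R i| < b.+1)%N.
    rewrite ltnS; apply: leq_trans (leq_bigmax i); rewrite -lez_nat.
    rewrite !gez0_abs ?dimvec_ge0//.
    exact: (dimvec_mono abC flC S i (@sub_mono _ _ L)).
  exists [ffun i => Ordinal (lt i)] => //; apply/rowP => i.
  by rewrite mxE ffunE /= gez0_abs ?dimvec_ge0.
have [s sE] := (finite_seqP _).1 fin.
have inS L : dim (sub_ob L) \in s.
  have : [set` s] (dim (sub_ob L)) by rewrite -sE; exists L.
  by [].
have s0 : (0 < size s)%N by have := inS (sub_full M); case: (s).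
have sz : (size s).-1.+1 = size s by rewrite prednK.
exists (size s).-1, (fun j => nth 0 s j); split=> [L|j].
  have lt : (index (dim (sub_ob L)) s < (size s).-1.+1)%N by rewrite sz index_mem.
  by exists (Ordinal lt); rewrite /= nth_index.
have : [set` s] (nth 0 s j) by rewrite /= mem_nth//; apply: leq_trans (ltn_ord j) _; rewrite sz.
by rewrite -sE => -[L _ e]; exists L.
Qed.

Definition maximizes (theta : K0_dual C R) L :=
  forall L', pairing theta (sub_ob L') <= pairing theta (sub_ob L).

Lemma pairing_dimvec (theta : K0_dual C R) X :
  pairing theta X = \sum_i pairing theta (S i) * (dim X 0 i)%:~R.
Proof.
rewrite (additive_ob_dimvec abC flC simS (@pairing_additive _ _ theta)).
by apply: eq_bigr => i _; rewrite mulrzr.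
Qed.

Lemma maximizer_exists theta : exists L, maximizes theta L.
Proof.
have [N [v [vL Lv]]] := finite_dimvecs.
pose F j : R := \sum_i pairing theta (S i) * (v j 0 i)%:~R.
have [j _ jmax] := arg_maxP F (isT : predT (ord0 : 'I_N.+1)).
have [L Lj] := Lv j; exists L => L'; have [j' L'j'] := vL L'.
by rewrite !pairing_dimvec L'j' Lj; exact: jmax.
Qed.

Section Theta.
Variable theta : K0_dual C R.
Local Notation th := (pairing theta).
Let thA : additive_ob th := @pairing_additive _ _ theta.

Lemma maximizes_iso U L : th (sub_ob U) = th (sub_ob L) -> maximizes theta U ->
  maximizes theta L.
Proof. by move=> e mU L'; rewrite -e; exact: mU. Qed.

Lemma maximizes_sub_eq U L : sub_eq U L -> maximizes theta U -> maximizes theta L.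
Proof.
by move=> /sub_eq_iso e; apply: maximizes_iso; exact: (additive_ob_iso abC thA e).
Qed.

Lemma maximizes_modular U L : maximizes theta U -> maximizes theta L ->
  exists I J, [/\ maximizes theta I, maximizes theta J,
    sub_le I U /\ sub_le I L & sub_le U J /\ sub_le L J].
Proof.
move=> mU mL; have [I [J [IU IL UJ LJ /(_ _ _ thA) e]]] := modular_law abC U L.
have eUL : th (sub_ob U) = th (sub_ob L) by apply/eqP; rewrite eq_le mU mL.
have eI : th (sub_ob U) = th (sub_ob I).
  by apply/eqP; rewrite eq_le mU -(lerD2r (th (sub_ob J))) e lerD2l mL.
exists I, J; split=> //; apply: maximizes_iso mU => //.
by apply: (addrI (th (sub_ob I))); rewrite e -eI eUL.
Qed.

Lemma least_maximizer : exists2 L, maximizes theta L &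
  forall U, maximizes theta U -> sub_le L U.
Proof.
have [L mL Lmin] := exists_minimizer (fun L => obsize (sub_ob L)) (maximizer_exists theta).
exists L => // U mU; have [I [_ [mI _ [IL IU] _]]] := maximizes_modular mL mU.
apply: sub_le_trans IU; have [h hE] := IL.
exact: (sub_iso_le hE (mono_obsize_iso abC (sub_le_mono hE) (Lmin I mI))).
Qed.

Lemma greatest_maximizer : exists2 L, maximizes theta L &
  forall U, maximizes theta U -> sub_le U L.
Proof.
have [L mL Lmin] := exists_minimizer
  (fun L => obsize M - obsize (sub_ob L))%N (maximizer_exists theta).
exists L => // U mU; have [_ [J [_ mJ _ [LJ UJ]]]] := maximizes_modular mL mU.
apply: sub_le_trans UJ _; have [h hE] := LJ.
apply: (sub_iso_le hE); apply: (mono_obsize_iso abC (flC := flC) (sub_le_mono hE)).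
have := Lmin J mJ; have := mono_obsize abC flC (@sub_mono _ _ L).
by have := mono_obsize abC flC (@sub_mono _ _ J); lia.
Qed.

(** A proper kernel K of L -> N is no maximizer, so theta(N) > 0.  If V is in
    T_theta with intersection I and sum J with L, modularity gives
    theta(V / I) = theta(J) - theta(L) <= 0, which forces V = I. *)
Lemma least_maximizer_torsion L : maximizes theta L ->
  (forall U, maximizes theta U -> sub_le L U) -> largest_in (Tss theta) L.
Proof.
move=> mL Lmin; split=> [N p ep nz|V TV].
  have [K [k se]] := epi_short_exact abC ep.
  pose K' := Subobject (mono_comp (@sub_mono _ _ L) (kernel_mono se.1)).
  have dE := thA se; rewrite lt_neqAle; apply/andP; split; last first.
    by have := mL K'; rewrite /= dE lerDl.
  apply/eqP => N0; apply: nz; have [|h hE] := Lmin K'.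
    by apply: maximizes_iso mL; rewrite dE -N0 addr0.
  have kh : k \oc h = idm _ by apply: (@sub_mono _ _ L); rewrite compA hE compm1.
  apply/is_zeroP; apply: ep; rewrite comp1m comp0m -(compm1 p) -kh compA se.1.1.
  by rewrite comp0m.
have [I [J [[h hE] IL VJ LJ /(_ _ _ thA) e]]] := modular_law abC V L.
have [N [q se]] := mono_short_exact abC (sub_le_mono hE).
have dE := thA se; apply: sub_le_trans IL; apply: (sub_iso_le hE).
have [zN|nzN] := pselect (is_zero N).
  apply: (mono_epi_iso abC (sub_le_mono hE)); apply/epiP => Z u uf.
  have [v <-] := cokernel_lift se.2 uf.
  by have [_ z] := zN Z; rewrite (z v) comp0m.
have := TV _ _ (cokernel_epi se.2) nzN.
by rewrite ltNge; case/negP; have := mL J; lra.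
Qed.

(** As V is in Tbar_theta, its quotient V / I has theta(V / I) >= 0, so that
    theta(J) >= theta(L): the sum J of V and L is a maximizer. *)
Lemma greatest_maximizer_torsion L : maximizes theta L ->
  (forall U, maximizes theta U -> sub_le U L) -> largest_in (Tbar theta) L.
Proof.
move=> mL Lmax; split=> [N p ep|V TV].
  have [K [k se]] := epi_short_exact abC ep.
  pose K' := Subobject (mono_comp (@sub_mono _ _ L) (kernel_mono se.1)).
  by have := mL K'; rewrite /= (thA se) lerDl.
have [I [J [[h hE] IL VJ LJ /(_ _ _ thA) e]]] := modular_law abC V L.
have [N [q se]] := mono_short_exact abC (sub_le_mono hE).
apply: sub_le_trans VJ _; apply: Lmax; apply: (maximizes_iso _ mL).
have := TV _ _ (cokernel_epi se.2); have := thA se => dE N0.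
by apply/eqP; rewrite eq_le mL andbT; lra.
Qed.

Lemma largest_in_unique (P : set C) U L : largest_in P U -> largest_in P L ->
  sub_eq U L.
Proof. by move=> [PU hU] [PL hL]; split; [exact: hL|exact: hU]. Qed.

Lemma tors_maximizer : maximizes theta (tors theta M) /\
  forall U, maximizes theta U -> sub_le (tors theta M) U.
Proof.
have [L mL Lmin] := least_maximizer; have LT := least_maximizer_torsion mL Lmin.
have TT : largest_in (Tss theta) (tors theta M).
  exact: (@xgetPex _ (sub_full M : {classic subobject M})
    (largest_in (Tss theta) (M := M)) (ex_intro _ L LT)).
have [LE EL] := largest_in_unique LT TT; split.
  exact: maximizes_sub_eq (conj LE EL) mL.
by move=> U /Lmin; exact: sub_le_trans.
Qed.

Lemma torsbar_maximizer : maximizes theta (torsbar theta M) /\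
  forall U, maximizes theta U -> sub_le U (torsbar theta M).
Proof.
have [L mL Lmin] := greatest_maximizer; have LT := greatest_maximizer_torsion mL Lmin.
have TT : largest_in (Tbar theta) (torsbar theta M).
  exact: (@xgetPex _ (sub_full M : {classic subobject M})
    (largest_in (Tbar theta) (M := M)) (ex_intro _ L LT)).
have [LE EL] := largest_in_unique LT TT; split.
  exact: maximizes_sub_eq (conj LE EL) mL.
by move=> U /Lmin UL; exact: sub_le_trans UL LE.
Qed.

Lemma wss_quotient : exists (h : mor (sub_ob (tors theta M)) (sub_ob (torsbar theta M)))
    (q : mor (sub_ob (torsbar theta M)) (wss theta M)),
  sub_mor (torsbar theta M) \oc h = sub_mor (tors theta M) /\ is_cokernel q h.
Proof.
have [h hE] := tors_maximizer.2 _ torsbar_maximizer.1.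
have [Q [q cq]] := ab_cokernel abC h.
pose P (W : C) := exists (h : mor (sub_ob (tors theta M)) (sub_ob (torsbar theta M)))
    (q : mor (sub_ob (torsbar theta M)) W),
  sub_mor (torsbar theta M) \oc h = sub_mor (tors theta M) /\ is_cokernel q h.
have PQ : P Q by exists h, q.
exact: (@xgetPex _ (M : {classic C}) P (ex_intro _ Q PQ)).
Qed.

(** Together with [subquotient_maximizer], the correspondence between maximizers L
    and the subobjects X = L / t_theta M of w_theta M on which theta vanishes. *)
Lemma maximizer_subquotient L : maximizes theta L ->
  exists X (m : mor X (wss theta M)), [/\ mono m, pairing theta X = 0 &
    forall (V : zmodType) (d : C -> V), additive_ob d ->
      d (sub_ob L) = d (sub_ob (tors theta M)) + d X].
Proof.
move=> mL; have [h [q [hE cq]]] := wss_quotient.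
have [mt tmin] := tors_maximizer; have [_ bmax] := torsbar_maximizer.
have [X [m [mm dE]]] := quotient_of_sub abC hE cq (tmin _ mL) (bmax _ mL).
exists X, m; split=> //; have := dE _ _ thA.
by have := mt L; have := mL (tors theta M); lra.
Qed.

Lemma subquotient_maximizer X (m : mor X (wss theta M)) : mono m ->
  exists L, [/\ pairing theta X <= 0, pairing theta X = 0 <-> maximizes theta L &
    forall (V : zmodType) (d : C -> V), additive_ob d ->
      d (sub_ob L) = d (sub_ob (tors theta M)) + d X].
Proof.
move=> mm; have [h [q [hE cq]]] := wss_quotient.
have [mt _] := tors_maximizer.
have [L [_ _ dE]] := sub_of_quotient abC hE cq mm.
exists L; have e := dE _ _ thA; split=> //; first by have := mt L; lra.
split=> [X0|mL]; first by apply: maximizes_iso mt; lra.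
by have := mt L; have := mL (tors theta M); lra.
Qed.

Lemma wss_Wss : Wss theta (wss theta M).
Proof.
have [h [q [hE cq]]] := wss_quotient.
have [mt _] := tors_maximizer; have [mb _] := torsbar_maximizer.
apply: Fbar_Wss => //.
  by move=> L i mi; have [L' []] := subquotient_maximizer mi.
have := thA (sub_quotient_exact abC hE cq).
by have := mt (torsbar theta M); have := mb (tors theta M); lra.
Qed.

End Theta.

Lemma wss_isomorphic (theta eta : K0_dual C R) :
  sub_eq (tors theta M) (tors eta M) -> sub_eq (torsbar theta M) (torsbar eta M) ->
  isomorphic (wss theta M) (wss eta M).
Proof.
move=> [[a aE] [a' a'E]] [[b bE] [b' b'E]].
have [h [q [hE cq]]] := wss_quotient theta.
have [h' [q' [h'E cq']]] := wss_quotient eta.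
have ba : b \oc h = h' \oc a.
  by apply: (@sub_mono _ _ (torsbar eta M)); rewrite compA bE hE compA h'E aE.
have ab' : b' \oc h' = h \oc a'.
  by apply: (@sub_mono _ _ (torsbar theta M)); rewrite compA b'E h'E compA hE a'E.
have bb' : b \oc b' = idm _.
  by apply: (@sub_mono _ _ (torsbar eta M)); rewrite compA bE b'E compm1.
have b'b : b' \oc b = idm _.
  by apply: (@sub_mono _ _ (torsbar theta M)); rewrite compA b'E bE compm1.
have cq2 : is_cokernel (q' \oc b) h.
  apply: cokernelI.
  - apply: epi_comp (cokernel_epi cq') _; apply: iso_epi; by exists b'.
  - by rewrite -compA ba compA cq'.1 comp0m.
  - move=> Z u uh; have [v vq] : exists v, v \oc q' = u \oc b'.
      by apply: (cokernel_lift cq'); rewrite -compA ab' compA uh comp0m.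
    by exists v; rewrite compA vq -compA b'b compm1.
by have [g ig _] := cokernel_isomorphic cq cq2; exists g.
Qed.

Lemma supp_eq_maximizes (theta eta : K0_dual C R) :
  sub_eq (tors theta M) (tors eta M) ->
  supp theta (wss theta M) `<=` supp eta (wss eta M) ->
  forall L, maximizes theta L -> maximizes eta L.
Proof.
move=> et sub L mL.
have [X [m [mm X0 dE]]] := maximizer_subquotient mL.
have eX := pairing_of_supp abC flC (wss_Wss theta) sub mm X0.
apply: (@maximizes_iso eta (tors theta M)).
  by rewrite (dE _ _ (@pairing_additive _ _ eta)) eX addr0.
apply: maximizes_sub_eq (tors_maximizer eta).1.
by case: et.
Qed.

Lemma maximizes_supp (theta eta : K0_dual C R) :
  (forall L, maximizes theta L <-> maximizes eta L) ->
  isomorphic (wss theta M) (wss eta M) ->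
  supp theta (wss theta M) `<=` supp eta (wss eta M).
Proof.
move=> H iw; apply: (@subset_trans _ (supp eta (wss theta M))); last exact: supp_iso.
have We := Wss_iso abC (isomorphic_sym iw) (wss_Wss eta).
apply: supp_transfer => //; first exact: wss_Wss.
move=> X m mm; have [L [_ tX dE]] := subquotient_maximizer mm.
rewrite tX H.
have mt : maximizes eta (tors theta M) by apply/H; exact: (tors_maximizer theta).1.
have e := dE _ _ (@pairing_additive _ _ eta); split=> [mL|X0].
  by have := mt L; have := mL (tors theta M); lra.
by apply: maximizes_iso mt; lra.
Qed.

Theorem TF_equiv_maximizes (theta eta : K0_dual C R) :
  TF_equiv M theta eta <-> forall L, maximizes theta L <-> maximizes eta L.
Proof.
split=> [[et eb es] L|H].
  split; apply: supp_eq_maximizes => //; rewrite ?es//.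
  by case: et.
have et : sub_eq (tors theta M) (tors eta M).
  have [mt tmin] := tors_maximizer theta; have [me emin] := tors_maximizer eta.
  by split; [apply/tmin/H|apply/emin/H].
have eb : sub_eq (torsbar theta M) (torsbar eta M).
  have [mt tmax] := torsbar_maximizer theta; have [me emax] := torsbar_maximizer eta.
  by split; [apply/emax/H|apply/tmax/H].
split=> //; have iw := wss_isomorphic et eb.
apply/seteqP; split; first exact: maximizes_supp.
apply: maximizes_supp; first by move=> L; split=> /H.
exact: isomorphic_sym.
Qed.

End Maximizers.

(** * Coordinates on the dual of the Grothendieck group *)

Section OfCoord.
Variables (C : preadd_cat) (abC : abelian C) (flC : finite_length C).
Variables (R : realType) (n : nat) (S : 'I_n -> C) (simS : simple_reps S).

Lemma pairing_of_coord (x : 'rV[R]_n) X :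
  pairing (of_coord S x) X = \sum_i x 0 i * (dimvec flC S X 0 i)%:~R.
Proof.
pose d X : R := \sum_i x 0 i * (dimvec flC S X 0 i)%:~R.
have dA : additive_ob d.
  move=> U V W f g /(dimvec_additive abC flC S) e; rewrite /d e -big_split.
  by apply: eq_bigr => i _; rewrite mxE intrD mulrDr.
have [theta thE] := K0_dual_lift dA.
have PS : (fun theta : K0_dual C R => forall i, pairing theta (S i) = x 0 i) theta.
  move=> i; rewrite thE /d (dimvec_simple abC flC simS) (bigD1 i)//= mxE !eqxx mulr1.
  by rewrite big1 ?addr0// => j ji; rewrite mxE (negPf ji) andbF mulr0.
have h := @xgetPex _ (\0 : {classic {additive K0 C -> R}})
       [set theta : K0_dual C R | forall i, pairing theta (S i) = x 0 i] (ex_intro _ theta PS).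
rewrite (pairing_dimvec abC flC simS); apply: eq_bigr => i _.
by congr (_ * _); exact: h.
Qed.

End OfCoord.

(** * Linear forms and neighbourhoods of row vectors *)

Section LinearForms.
Variables (R : realType) (n : nat).
Implicit Types (x y z : 'rV[R]_n) (u : 'cV[R]_n).

Definition form u x : R := (x *m u) 0 0.

Lemma formD u x y : form u (x + y) = form u x + form u y.
Proof. by rewrite /form mulmxDl mxE. Qed.

Lemma formZ u a x : form u (a *: x) = a * form u x.
Proof. by rewrite /form -scalemxAl mxE. Qed.

Lemma form0 u : form u 0 = 0.
Proof. by rewrite /form mul0mx mxE. Qed.

Lemma form_sum u (I : Type) (r : seq I) (F : I -> 'rV[R]_n) :
  form u (\sum_(i <- r) F i) = \sum_(i <- r) form u (F i).
Proof. by rewrite /form mulmx_suml summxE. Qed.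

Lemma formBl u w x : form (u - w) x = form u x - form w x.
Proof. by rewrite /form mulmxBr !mxE. Qed.

Lemma form_suml (I : Type) (r : seq I) (P : pred I) (F : I -> 'cV[R]_n) x :
  form (\sum_(i <- r | P i) F i) x = \sum_(i <- r | P i) form (F i) x.
Proof. by rewrite /form mulmx_sumr summxE. Qed.

Lemma form_continuous u : continuous (form u).
Proof.
have -> : form u = (fun y => \sum_i y 0 i * u i 0) by apply/funext => y; rewrite /form mxE.
elim: (index_enum _) => [|i r IH] x.
  have -> : (fun y : 'rV[R]_n => \sum_(i <- [::]) y 0 i * u i 0) = cst 0.
    by apply/funext => y; rewrite big_nil.
  exact: cst_continuous.
have -> : (fun y : 'rV[R]_n => \sum_(j <- i :: r) y 0 j * u j 0) =
    (fun y => y 0 i * u i 0 + \sum_(j <- r) y 0 j * u j 0).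
  by apply/funext => y; rewrite big_cons.
apply: (@continuousD _ _ _ (fun y : 'rV[R]_n => y 0 i * u i 0)) => //; last exact: IH.
apply: (@continuousM _ _ (fun y : 'rV[R]_n => y 0 i) (cst (u i 0))).
  exact: coord_continuous.
exact: cst_continuous.
Qed.

Lemma near_form_gt0 u x : 0 < form u x -> \forall y \near x, 0 < form u y.
Proof.
exact: (@cvgr_gt _ _ (nbhs x) _ (form u) (form u x) (@form_continuous u x) 0).
Qed.

Lemma ray_meets_nbhs z e (B : set 'rV[R]_n) : nbhs z B ->
  exists2 t : R, 0 < t & B (z + t *: e).
Proof.
move=> [P zP PB].
suff : \forall t \near (0 : R)^'+, 0 < t /\ B (z + t *: e) by move=> /filter_ex[t []]; exists t.
have H : \forall t \near (0 : R)^'+, forall i j, P i j ((z + t *: e) i j).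
  apply: filter_forall => i; apply: filter_forall => j.
  have c : (fun t : R => (z + t *: e) i j) @ (0 : R)^'+ --> z i j.
    have -> : (fun t : R => (z + t *: e) i j) = (fun t : R => z i j + t * e i j).
      by apply/funext => t; rewrite !mxE.
    have := @cvgD _ _ _ (0 : R)^'+ _ (cst (z i j)) (fun t : R => t * e i j) _ _
      (cvg_cst _) (@cvgMr_tmp _ _ (0 : R)^'+ _ id _ (e i j)
         (cvg_within_filter _ (@cvg_id _ (nbhs (0 : R))))).
    by rewrite mul0r addr0; exact.
  exact: c (zP i j).
by near=> t; split; [near: t; exact: nbhs_right_gt|apply: PB; near: t].
Unshelve. all: by end_near. Qed.

End LinearForms.

(** * Integral halfspaces cut out integrally generated cones *)

Section FinitelyGeneratedCones.
Variables (R : realType) (n : nat).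

Section ConeOf.
Variables (m : nat) (v : 'I_m -> 'rV[R]_n).

Lemma cone_of0 : cone_of v 0.
Proof. by exists (fun=> 0) => //; rewrite big1// => i _; rewrite scale0r. Qed.

Lemma cone_ofD x y : cone_of v x -> cone_of v y -> cone_of v (x + y).
Proof.
move=> [c c0 ->] [d d0 ->]; exists (fun i => c i + d i).
  by move=> i; rewrite addr_ge0.
by rewrite -big_split; apply: eq_bigr => i _; rewrite scalerDl.
Qed.

Lemma cone_ofZ a x : 0 <= a -> cone_of v x -> cone_of v (a *: x).
Proof.
move=> a0 [c c0 ->]; exists (fun i => a * c i).
  by move=> i; rewrite mulr_ge0.
by rewrite scaler_sumr; apply: eq_bigr => i _; rewrite scalerA.
Qed.

Lemma cone_of_gen i : cone_of v (v i).
Proof.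
exists (fun j => (j == i)%:R) => [j|]; first exact: ler0n.
by rewrite (bigD1 i)//= eqxx scale1r big1 ?addr0// => j /negPf ->; rewrite scale0r.
Qed.

Lemma cone_of_sum (I : Type) (r : seq I) (P : pred I) (F : I -> 'rV[R]_n) :
  (forall i, P i -> cone_of v (F i)) -> cone_of v (\sum_(i <- r | P i) F i).
Proof.
by move=> h; elim/big_ind: _ => //; [exact: cone_of0|exact: cone_ofD].
Qed.

End ConeOf.

Definition int_cone (gs : seq 'rV[int]_n) : set 'rV[R]_n :=
  cone_of (fun i : 'I_(size gs) => map_mx intr (gs`_i)).

Lemma int_cone_gen gs g : g \in gs -> int_cone gs (map_mx intr g).
Proof.
move=> /(nthP 0)[i iS <-].
exact: (@cone_of_gen _ (fun i : 'I_(size gs) => map_mx intr (gs`_i)) (Ordinal iS)).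
Qed.

Lemma int_cone_sub gs gs' : (forall g, g \in gs -> int_cone gs' (map_mx intr g)) ->
  int_cone gs `<=` int_cone gs'.
Proof.
move=> h _ [c c0 ->]; apply: cone_of_sum => i _; apply: cone_ofZ => //.
by apply: h; exact: mem_nth.
Qed.

Definition int_form (c : 'cV[int]_n) (g : 'rV[int]_n) : int := (g *m c) 0 0.

Lemma form_map c g : form (map_mx intr c) (map_mx intr g) = (int_form c g)%:~R :> R.
Proof. by rewrite /form -map_mxM mxE. Qed.

Lemma int_cone_full : exists gs, int_cone gs = setT.
Proof.
pose gs : seq 'rV[int]_n := [seq delta_mx 0 i | i <- enum 'I_n] ++
  [seq - delta_mx 0 i | i <- enum 'I_n].
exists gs; apply/seteqP; split=> // x _.
rewrite (row_sum_delta x); apply: cone_of_sum => i _.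
have [x0|x0] := leP 0 (x 0 i).
  apply: cone_ofZ => //; have -> : delta_mx 0 i = map_mx intr (delta_mx 0 i) :> 'rV[R]_n.
    by rewrite map_delta_mx.
  by apply: int_cone_gen; rewrite mem_cat; apply/orP; left; apply/mapP; exists i; rewrite ?mem_enum.
have -> : x 0 i *: delta_mx 0 i = (- x 0 i) *: map_mx intr (- delta_mx 0 i) :> 'rV[R]_n.
  by rewrite map_mxN map_delta_mx scaleNr scalerN opprK.
apply: cone_ofZ; first by rewrite oppr_ge0 ltW.
by apply: int_cone_gen; rewrite mem_cat; apply/orP; right; apply/mapP; exists i; rewrite ?mem_enum.
Qed.

(** One step of the double description method.  The new generators are the old
    ones g with c(g) >= 0, and the combinations c(g) h - c(h) g, which lie on the
    hyperplane c = 0, for c(g) > 0 > c(h). *)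
Lemma int_cone_halfspace gs c : exists gs',
  int_cone gs' = int_cone gs `&` [set x | 0 <= form (map_mx intr c) x].
Proof.
pose comb g h : 'rV[int]_n := int_form c g *: h - int_form c h *: g.
pose gs' := [seq g <- gs | 0 <= int_form c g] ++
  [seq comb g h | g <- [seq g <- gs | 0 < int_form c g], h <- [seq g <- gs | int_form c g < 0]].
have combE g h : map_mx intr (comb g h) =
   (int_form c g)%:~R *: map_mx intr h - (int_form c h)%:~R *: map_mx intr g :> 'rV[R]_n.
  by rewrite map_mxB !map_mxZ.
have comb0 g h : int_form c (comb g h) = 0.
  by rewrite /comb /int_form mulmxBl -!scalemxAl [LHS]mxE [X in _ + X]mxE [X in X - _]mxE
      [X in _ - X]mxE mulrC subrr.
exists gs'; apply/seteqP; split=> [x gx|x [[a a0 xE] cx]].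
  split.
    apply: int_cone_sub gx => g; rewrite mem_cat => /orP[|/allpairsP[[p q] /=[]]].
      by rewrite mem_filter => /andP[_]; exact: int_cone_gen.
    rewrite !mem_filter => /andP[p0 pg] /andP[q0 qg] ->; rewrite combE.
    rewrite -scaleNr; apply: cone_ofD; apply: cone_ofZ; try exact: int_cone_gen.
      by rewrite ler0z ltW.
    by rewrite oppr_ge0 lerz0 ltW.
  have [a a0 ->] := gx; rewrite /= form_sum; apply: sumr_ge0 => i _.
  rewrite formZ mulr_ge0// form_map ler0z.
  have := mem_nth 0 (ltn_ord i); rewrite mem_cat => /orP[|/allpairsP[[p q] /=[_ _ ->]]].
    by rewrite mem_filter => /andP[].
  by rewrite comb0.
pose l i : R := (int_form c gs`_i)%:~R.
have lE (i : 'I_(size gs)) : form (map_mx intr c) (map_mx intr gs`_i) = l i by exact: form_map.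
(* With x a combination of the generators with coefficients a, P and -Q are the
   parts of c(x) coming from the generators where c is positive and negative. *)
pose P : R := \sum_(i < size gs | 0 < l i) a i * l i.
pose Q : R := \sum_(i < size gs | l i < 0) a i * - l i.
have PQ : Q <= P.
  rewrite -subr_ge0; suff <- : form (map_mx intr c) x = P - Q by [].
  rewrite xE form_sum /P /Q -sumrN [X in X + _]big_mkcond [X in _ + X]big_mkcond.
  rewrite -big_split /=; apply: eq_bigr => i _; rewrite formZ lE.
  by case: ltgtP => [l0|l0|<-]; rewrite ?addr0 ?add0r ?mulrN ?opprK ?mulr0.
have split_x : x = \sum_(i < size gs | 0 < l i) a i *: map_mx intr gs`_i
   + (\sum_(i < size gs | l i < 0) a i *: map_mx intr gs`_i
   + \sum_(i < size gs | l i == 0) a i *: map_mx intr gs`_i).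
  rewrite xE (bigID (fun i : 'I__ => 0 < l i)) /=; congr (_ + _).
  rewrite (bigID (fun i : 'I__ => l i < 0)) /=; congr (_ + _); apply: eq_bigl => i.
    by rewrite -leNgt andb_idl// => /ltW.
  by rewrite -!leNgt eq_le.
have gen (i : 'I_(size gs)) : 0 <= l i -> int_cone gs' (map_mx intr gs`_i).
  move=> li; apply: int_cone_gen; rewrite mem_cat mem_filter mem_nth//.
  by rewrite -(ler0z R) li.
have genc (i j : 'I_(size gs)) : 0 < l i -> l j < 0 ->
    int_cone gs' (l i *: map_mx intr gs`_j - l j *: map_mx intr gs`_i).
  move=> li lj; rewrite -combE; apply: int_cone_gen; rewrite mem_cat; apply/orP; right.
  by apply/allpairsP; exists (gs`_i, gs`_j);
    rewrite !mem_filter !mem_nth// -(ltr0z R) -(ltrz0 R) li lj.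
have zero_part : int_cone gs' (\sum_(i < size gs | l i == 0) a i *: map_mx intr gs`_i).
  by apply: cone_of_sum => i /eqP li; apply: cone_ofZ => //; apply: gen; rewrite li.
have Q0 : 0 <= Q.
  by apply: sumr_ge0 => i li; rewrite mulr_ge0// oppr_ge0 ltW.
rewrite split_x addrA; apply: cone_ofD => //.
have [P0|P0] := eqVneq P 0.
  have Q00 : Q = 0 by apply/eqP; rewrite eq_le Q0 -P0 PQ.
  rewrite [X in _ + X]big1 ?addr0; last first.
    move=> i li; suff -> : a i = 0 by rewrite scale0r.
    have ge0 (j : 'I_(size gs)) : l j < 0 -> 0 <= a j * - l j.
      by move=> lj; rewrite mulr_ge0// oppr_ge0 ltW.
    have /eqP := psumr_eq0P ge0 Q00 li.
    by rewrite mulf_eq0 oppr_eq0 (lt_eqF li) orbF => /eqP.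
  by apply: cone_of_sum => i li; apply: cone_ofZ => //; apply: gen; exact: ltW.
have Pp : 0 < P by rewrite lt_def P0 (le_trans Q0).
(* The combinations of g_i and g_j with weights a_i a_j / P absorb the whole
   negative part, and use up the fraction Q / P of the positive one. *)
suff -> : \sum_(i < size gs | 0 < l i) a i *: map_mx intr gs`_i
   + \sum_(i < size gs | l i < 0) a i *: map_mx intr gs`_i =
   \sum_(i < size gs | 0 < l i) (((P - Q) / P) * a i) *: map_mx intr gs`_i +
   \sum_(i < size gs | 0 < l i) \sum_(j < size gs | l j < 0)
     (a i * a j / P) *: (l i *: map_mx intr gs`_j - l j *: map_mx intr gs`_i) :> 'rV[R]_n.
  apply: cone_ofD; apply: cone_of_sum => i li.
    apply: cone_ofZ; last exact/gen/ltW.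
    by rewrite mulr_ge0// divr_ge0 ?subr_ge0// ltW.
  apply: cone_of_sum => j lj; apply: cone_ofZ; last exact: genc.
  by rewrite divr_ge0 ?mulr_ge0// ltW.
have -> : \sum_(i < size gs | 0 < l i) \sum_(j < size gs | l j < 0)
     (a i * a j / P) *: (l i *: map_mx intr gs`_j - l j *: map_mx intr gs`_i) =
   \sum_(j < size gs | l j < 0) a j *: map_mx intr gs`_j +
   \sum_(i < size gs | 0 < l i) (Q / P * a i) *: map_mx intr gs`_i :> 'rV[R]_n.
  under eq_bigr => i _ do under eq_bigr => j _ do rewrite scalerBr !scalerA.
  under eq_bigr => i _ do rewrite big_split /= sumrN.
  rewrite big_split /=; congr (_ + _).
    rewrite exchange_big /=; apply: eq_bigr => j _; rewrite -scaler_suml; congr (_ *: _).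
    rewrite (eq_bigr (fun i : 'I__ => a j / P * (a i * l i))) => [|i _]; last by ring.
    by rewrite -mulr_sumr -/P -mulrA mulVf// mulr1.
  apply: eq_bigr => i _; rewrite -scaler_suml -scaleNr; congr (_ *: _).
  rewrite -sumrN (eq_bigr (fun j : 'I__ => a i / P * (a j * - l j))) => [|j _]; last by ring.
  by rewrite -mulr_sumr -/Q; ring.
rewrite [LHS]addrC [RHS]addrCA; congr (_ + _); rewrite -big_split /=; apply: eq_bigr => i _.
rewrite -scalerDl; congr (_ *: _); rewrite -mulrDl -mulrDl subrK.
by rewrite divff// mul1r.
Qed.

Lemma rational_cone_halfspaces (cs : seq 'cV[int]_n) :
  rational_cone [set x : 'rV[R]_n | forall c, c \in cs -> 0 <= form (map_mx intr c) x].
Proof.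
suff [gs gsE] : exists gs, int_cone gs =
    [set x : 'rV[R]_n | forall c, c \in cs -> 0 <= form (map_mx intr c) x].
  by exists (size gs), (fun i => gs`_i); rewrite -gsE.
elim: cs => [|c cs [gs IH]].
  by have [gs e] := int_cone_full; exists gs; rewrite e; apply/seteqP; split.
have [gs' e] := int_cone_halfspace gs c; exists gs'; rewrite e IH.
apply/seteqP; split=> [x [h1 h2] d|x h]; first by rewrite inE => /predU1P[->|/h1].
by split=> [d dc|]; apply: h; rewrite inE ?eqxx ?dc ?orbT.
Qed.

End FinitelyGeneratedCones.

(** * The normal fan of a finite family of lattice points *)

Section NormalFan.
Variables (R : realType) (n N : nat) (v : 'I_N.+1 -> 'rV[int]_n).
Implicit Types (x y z : 'rV[R]_n) (F G : {set 'I_N.+1}).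

Definition point_form j : 'cV[R]_n := map_mx intr (v j)^T.
Local Notation val j x := (form (point_form j) x).

Definition argmax x : {set 'I_N.+1} := [set j | [forall k, val k x <= val j x]].

Lemma argmaxP x j : reflect (forall k, val k x <= val j x) (j \in argmax x).
Proof. by rewrite inE; apply: forallP. Qed.

Lemma argmax_eq x j k : j \in argmax x -> k \in argmax x -> val j x = val k x.
Proof. by move=> /argmaxP jx /argmaxP kx; apply/eqP; rewrite eq_le jx kx. Qed.

Lemma argmax_neq0 x : exists j, j \in argmax x.
Proof.
have [j _ jmax] := arg_maxP (fun j => val j x) (isT : predT (ord0 : 'I_N.+1)).
by exists j; apply/argmaxP => k; exact: jmax.
Qed.

Lemma argmax_exp x j k : j \in argmax x -> val j x <= val k x -> k \in argmax x.
Proof. by move=> /argmaxP jx jk; apply/argmaxP => i; exact: le_trans (jx i) jk. Qed.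

Lemma argmaxZ a x : 0 < a -> argmax (a *: x) = argmax x.
Proof.
move=> a0; apply/setP => j; apply/argmaxP/argmaxP => h k.
  by have := h k; rewrite !formZ ler_pM2l.
by rewrite !formZ ler_pM2l.
Qed.

(** If x and y attain their maxima at a common point, then the maximum of x + y is
    the sum of their maxima. *)
Lemma argmaxD x y j : j \in argmax x -> j \in argmax y ->
  argmax (x + y) = (argmax x :&: argmax y)%SET.
Proof.
move=> jx jy; have jxP := argmaxP _ _ jx; have jyP := argmaxP _ _ jy.
apply/setP => k; rewrite finset.in_setI; apply/idP/andP => [/argmaxP kxy|[/argmaxP kx /argmaxP ky]].
  have := kxy j; rewrite !formD => h.
  by split; [apply: (argmax_exp jx)|apply: (argmax_exp jy)]; have := jxP k; have := jyP k; lra.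
by apply/argmaxP => i; rewrite !formD lerD.
Qed.

Definition normal_cone F : set 'rV[R]_n := [set x | F \subset argmax x].

Definition argmax_class x : set 'rV[R]_n := [set y | argmax y = argmax x].

Lemma normal_cone_argmax x : normal_cone (argmax x) x.
Proof. exact: subxx. Qed.

Lemma normal_coneD F x y : F != finset.set0 ->
  normal_cone F x -> normal_cone F y -> normal_cone F (x + y).
Proof.
move=> /finset.set0Pn[j jF] Fx Fy; rewrite /normal_cone /=.
rewrite (argmaxD (fintype.subsetP Fx _ jF) (fintype.subsetP Fy _ jF)).
by rewrite finset.subsetI Fx Fy.
Qed.

Lemma argmax_set0 x : argmax x != finset.set0.
Proof. by have [j jx] := argmax_neq0 x; apply/finset.set0Pn; exists j. Qed.

Lemma normal_cone_rational F : rational_cone (normal_cone F).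
Proof.
pose cs := [seq (v j - v k)^T | j <- enum F, k <- enum 'I_N.+1].
suff -> : normal_cone F = [set x | forall c, c \in cs -> 0 <= form (map_mx intr c) x].
  exact: rational_cone_halfspaces.
have cE j k x : form (map_mx intr (v j - v k)^T) x = val j x - val k x.
  by rewrite -formBl /point_form -map_mxB -raddfB.
apply/seteqP; split=> [x Fx c /allpairsP[[j k] /= [jF _ ->]]|x h].
  rewrite cE subr_ge0; move: k; apply/argmaxP; apply: (fintype.subsetP Fx).
  by rewrite mem_enum in jF.
apply/fintype.subsetP => j jF; apply/argmaxP => k; rewrite -subr_ge0 -cE; apply: h.
by apply/allpairsP; exists (j, k); rewrite !mem_enum.
Qed.

(** From y in the cone, moving slightly towards x enters the class of x. *)
Lemma closure_argmax_class x : closure (argmax_class x) = normal_cone (argmax x).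
Proof.
apply/seteqP; split=> [y cy|y Fy B By].
  apply/fintype.subsetP => j jx; apply/argmaxP => k; rewrite leNgt; apply/negP => lt.
  have := @near_form_gt0 R n (point_form k - point_form j) y; rewrite formBl subr_gt0.
  move=> /(_ lt) /cy [z [/= zx]]; rewrite formBl subr_gt0 ltNge.
  by case/negP; move: k {lt}; apply/argmaxP; rewrite zx.
have [t t0 Bt] := ray_meets_nbhs x By.
exists (y + t *: x); split=> //=; have [j jx] := argmax_neq0 x.
rewrite /argmax_class /= (@argmaxD _ _ j) ?argmaxZ//; last exact: (fintype.subsetP Fy).
exact/finset.setIidPr.
Qed.

Lemma linspan_sub (s : set 'rV[R]_n) x : s x -> linspan s x.
Proof.
move=> sx; exists 1%N, (fun=> 1), (fun=> x); split=> //.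
by rewrite big_ord1 scale1r.
Qed.

Lemma near_argmax z : \forall y \near z, forall j k,
  j \in argmax z -> k \notin argmax z -> 0 < form (point_form j - point_form k) y.
Proof.
apply: (@filter_forall _ _ _ (nbhs z) (nbhs_filter z)) => j.
apply: (@filter_forall _ _ _ (nbhs z) (nbhs_filter z)) => k.
have [jz|jz] := boolP (j \in argmax z); last exact: nearW.
have [kz|kz] := boolP (k \in argmax z); first exact: nearW.
have : 0 < form (point_form j - point_form k) z.
  rewrite formBl subr_gt0 ltNge; apply/negP => jk; move: kz.
  by rewrite (argmax_exp jz).
by move=> /near_form_gt0; apply: filterS => y.
Qed.

(** From a relative interior point z, one can move a little beyond z away from x
    and stay in the cone; then z lies strictly between that point and x, so its
    argmax is contained in that of x.  Conversely, the equations hold on the whole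
    span, and the strict inequalities near z. *)
Lemma relint_argmax_class x : relint (normal_cone (argmax x)) = argmax_class x.
Proof.
apply/seteqP; split=> [z [zl zn]|z zx].
  have sz : normal_cone (argmax x) z by apply: (nbhs_singleton zn).
  have [t t0 /= Bt] := ray_meets_nbhs (z - x) zn.
  have sp : normal_cone (argmax x) (z + t *: (z - x)).
    apply: Bt; exists 2%N, (fun i => if i == 0 :> 'I_2 then 1 + t else - t),
      (fun i => if i == 0 :> 'I_2 then z else x).
    split=> [i|]; first by case: ifP => _ //; exact: normal_cone_argmax.
    by rewrite big_ord_recl big_ord1 /= scalerDl scale1r scalerBr scaleNr addrA.
  have [j jx] := argmax_neq0 x.
  have e : (1 + t) *: z = (z + t *: (z - x)) + t *: x.
    by rewrite scalerDl scale1r scalerBr -addrA subrK.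
  rewrite /argmax_class /= -(@argmaxZ (1 + t)) ?addr_gt0// e (@argmaxD _ _ j) ?argmaxZ//.
    exact/finset.setIidPr.
  exact: (fintype.subsetP sp).
have sz : normal_cone (argmax x) z by rewrite /normal_cone /= zx.
split; first exact: linspan_sub.
have := near_argmax z; rewrite zx => H.
(* On the span, the values at the points of argmax x agree with each other. *)
apply: filterS H => y Hy [m [c [w [sw yE]]]].
apply/fintype.subsetP => j jx; apply/argmaxP => k.
have [kx|kx] := boolP (k \in argmax x); last first.
  by have := Hy j k jx kx; rewrite formBl subr_gt0 => /ltW.
rewrite yE !form_sum le_eqVlt; apply/orP; left; apply/eqP; apply: eq_bigr => i _.
by rewrite !formZ (argmax_eq (fintype.subsetP (sw i) _ jx) (fintype.subsetP (sw i) _ kx)).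
Qed.

(** The supporting form adds up, over k in G, the difference between the maximum
    and the value at the k-th point; it vanishes when each k in G is maximal. *)
Lemma face_normal_cone F G : F != finset.set0 ->
  Face (normal_cone F) (normal_cone F `&` normal_cone G).
Proof.
move=> /finset.set0Pn[j jF]; exists (\sum_(k in G) (point_form j - point_form k)).
have ge0 x k : normal_cone F x -> 0 <= form (point_form j - point_form k) x.
  by move=> Fx; rewrite formBl subr_ge0; move: k; apply/argmaxP; exact: (fintype.subsetP Fx).
split=> [x Fx|].
  by rewrite -/(form _ x) form_suml; apply: sumr_ge0 => k _; exact: ge0.
apply/seteqP; split=> x [Fx Gx]; split=> //; have jx := fintype.subsetP Fx _ jF.
  rewrite -/(form _ x) form_suml big1// => k kG; rewrite formBl.
  by rewrite (argmax_eq jx (fintype.subsetP Gx _ kG)) subrr.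
apply/fintype.subsetP => k kG; apply: argmax_exp jx _; rewrite -subr_le0 -formBl.
move: Gx; rewrite -/(form _ x) form_suml => Gx.
by rewrite (psumr_eq0P _ Gx kG)// => i _; exact: ge0.
Qed.

(** Choose z in the face tau with the fewest maximizing points.  For y in tau, the
    sum z + y is in tau and its argmax is the intersection of those of z and y, so
    minimality puts y in the cone of z.  Conversely, for y in the cone of z, a small
    move from z in the direction -y stays in the cone; the form u vanishes at z and
    is nonnegative on the cone, so u(y) <= 0. *)
Lemma Face_normal_coneP F (tau : set 'rV[R]_n) : F != finset.set0 -> Face (normal_cone F) tau ->
  exists2 z, F \subset argmax z & tau = normal_cone (argmax z).
Proof.
move=> F0 [u [u_ge0 tauE]]; rewrite -/(form u _) in u_ge0 tauE.
have F_0 : normal_cone F 0.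
  by apply/fintype.subsetP => j _; apply/argmaxP => k; rewrite !form0.
have tau0 : tau 0 by rewrite tauE; split=> //; exact: form0.
have [z tz zmin] := exists_minimizer (fun z => #|argmax z|) (ex_intro tau 0 tau0).
have : tau z := tz; rewrite {1}tauE => -[Fz uz]; exists z => //.
apply/seteqP; split=> y.
  move=> ty; move: (ty); rewrite tauE => -[Fy uy].
  have /finset.set0Pn[j jF] := F0.
  have e := argmaxD (fintype.subsetP Fz _ jF) (fintype.subsetP Fy _ jF).
  have : tau (z + y).
    rewrite tauE; split; first exact: normal_coneD.
    by change (form u (z + y) = 0); rewrite formD [form u z]uz [form u y]uy addr0.
  move=> /zmin; rewrite e => le.
  rewrite /normal_cone /=; apply/finset.setIidPl/eqP; rewrite eqEcard le andbT.
  exact: finset.subsetIl.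
move=> Gy; have Fy : normal_cone F y by exact: fintype.subset_trans Fz Gy.
rewrite tauE; split=> //; apply/eqP; rewrite eq_le u_ge0// andbT.
have [t t0 Ht] := ray_meets_nbhs (- y) (near_argmax z).
have Fp : normal_cone F (z + t *: - y).
  apply/fintype.subsetP => j jF; have jz := fintype.subsetP Fz _ jF.
  apply/argmaxP => k; have [kz|kz] := boolP (k \in argmax z); last first.
    by have := Ht j k jz kz; rewrite formBl subr_gt0 => /ltW.
  have e1 := argmax_eq jz kz.
  have e2 := argmax_eq (fintype.subsetP Gy _ jz) (fintype.subsetP Gy _ kz).
  by rewrite !formD !formZ -scaleN1r !formZ e1 e2.
have := u_ge0 _ Fp; rewrite -/(form u _) formD [form u z]uz add0r formZ -scaleN1r formZ.
by rewrite mulN1r mulrN oppr_ge0 pmulr_rle0.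
Qed.

Definition argmax_classes : set (set 'rV[R]_n) := [set E | exists x, E = argmax_class x].
Definition normal_fan : set (set 'rV[R]_n) := [set closure E | E in argmax_classes].

Lemma normal_fanP sigma : normal_fan sigma <-> exists x, sigma = normal_cone (argmax x).
Proof.
split=> [[_ [x ->] <-]|[x ->]]; first by exists x; exact: closure_argmax_class.
by exists (argmax_class x); [exists x|exact: closure_argmax_class].
Qed.

Lemma relint_closure_argmax_class E : argmax_classes E -> relint (closure E) = E.
Proof. by move=> [x ->]; rewrite closure_argmax_class relint_argmax_class. Qed.

Lemma closure_relint_normal_fan sigma : normal_fan sigma -> closure (relint sigma) = sigma.
Proof. by move=> /normal_fanP[x ->]; rewrite relint_argmax_class closure_argmax_class. Qed.

Lemma Face_normal_fan sigma : normal_fan sigma -> Face sigma `<=` normal_fan.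
Proof.
move=> /normal_fanP[x ->] tau /(Face_normal_coneP (argmax_set0 x))[z _ ->].
by apply/normal_fanP; exists z.
Qed.

Lemma normal_fan_rational : rational_fan normal_fan.
Proof.
split; last by move=> _ /normal_fanP[x ->]; exact: normal_cone_rational.
split; last 2 first.
- exact: Face_normal_fan.
- move=> _ _ /normal_fanP[x ->] /normal_fanP[y ->]; split; first exact/face_normal_cone/argmax_set0.
  by rewrite setIC; exact/face_normal_cone/argmax_set0.
- move=> _ /normal_fanP[x ->]; have [m [w ->]] := normal_cone_rational (argmax x).
  by exists m, (fun i => map_mx intr (w i)).
Qed.

Lemma normal_fan_finite : finite_set normal_fan.
Proof.
apply: (@sub_finite_set _ _ [set normal_cone F | F in [set: {set 'I_N.+1}]]).
  by move=> _ /normal_fanP[x ->]; exists (argmax x).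
exact/finite_image/finite_finset.
Qed.

Lemma normal_fan_complete : complete_fan normal_fan.
Proof.
apply/seteqP; split=> // x _; exists (normal_cone (argmax x)); last exact: normal_cone_argmax.
by apply/normal_fanP; exists x.
Qed.

Lemma closure_bij : set_bij argmax_classes normal_fan (fun E => closure E).
Proof.
split=> [E aE|E E' /set_mem aE /set_mem aE' e|sigma [E aE <-]].
- by exists E.
- by rewrite -(relint_closure_argmax_class aE) e relint_closure_argmax_class.
- by exists E.
Qed.

Lemma relint_bij : set_bij normal_fan argmax_classes (fun sigma => relint sigma).
Proof.
split=> [_ /normal_fanP[x ->]|s s' /set_mem aE /set_mem aE' e|E aE].
- by exists x; exact: relint_argmax_class.
- by rewrite -(closure_relint_normal_fan aE) e closure_relint_normal_fan.
- by exists (closure E); [exists E|exact: relint_closure_argmax_class].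
Qed.

Lemma normal_fan_face_decomposition sigma : normal_fan sigma ->
  [/\ sigma = \bigcup_(tau in Face sigma) relint tau,
      trivIset (Face sigma) (fun tau => relint tau)
    & [set relint tau | tau in Face sigma] =
      [set E | argmax_classes E /\ E `&` sigma !=set0]].
Proof.
move=> /normal_fanP[x ->]; have x0 := argmax_set0 x.
have faceI z : argmax x \subset argmax z -> Face (normal_cone (argmax x)) (normal_cone (argmax z)).
  move=> xz; have <- : normal_cone (argmax x) `&` normal_cone (argmax z) = normal_cone (argmax z).
    by apply/setIidPr => y; exact: fintype.subset_trans.
  exact: face_normal_cone.
split.
- apply/seteqP; split=> [y xy|y [_ /(Face_normal_coneP x0)[z xz ->]]].
    exists (normal_cone (argmax y)); first exact: faceI.
    by rewrite relint_argmax_class.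
  by rewrite relint_argmax_class /normal_cone /= => ->.
- move=> _ _ /(Face_normal_coneP x0)[z xz ->] /(Face_normal_coneP x0)[w xw ->].
  by rewrite !relint_argmax_class => -[y [/= <- <-]].
- apply/seteqP; split=> [_ [_ /(Face_normal_coneP x0)[z xz ->] <-]|_ [[z ->] [y [/= yz xy]]]].
    rewrite relint_argmax_class; split; first by exists z.
    by exists z.
  exists (normal_cone (argmax y)); first exact: faceI.
  by rewrite relint_argmax_class /argmax_class yz.
Qed.

End NormalFan.

(** * TF classes and the normal fan *)

Section TFNormalFan.
Variables (C : preadd_cat) (abC : abelian C) (flC : finite_length C).
Variables (R : realType) (n : nat) (S : 'I_n -> C) (simS : simple_reps S).
Variable M : C.

Variables (N : nat) (v : 'I_N.+1 -> 'rV[int]_n).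
Hypothesis dim_v : forall L : subobject M, exists j, dimvec flC S (sub_ob L) = v j.
Hypothesis v_dim : forall j, exists L : subobject M, dimvec flC S (sub_ob L) = v j.

Lemma pairing_point_form (x : 'rV[R]_n) (L : subobject M) j :
  dimvec flC S (sub_ob L) = v j ->
  pairing (of_coord S x) (sub_ob L) = form (point_form R v j) x.
Proof.
move=> Lj; rewrite (pairing_of_coord abC flC simS) Lj /form /point_form mxE.
by apply: eq_bigr => i _; rewrite !mxE.
Qed.

Lemma maximizes_argmax (x : 'rV[R]_n) (L : subobject M) j :
  dimvec flC S (sub_ob L) = v j ->
  maximizes (of_coord S x) L <-> j \in argmax v x.
Proof.
move=> Lj; split=> [mL|/argmaxP jx L'].
  apply/argmaxP => k; have [L' Lk] := v_dim k.
  by rewrite -(pairing_point_form x Lj) -(pairing_point_form x Lk).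
by have [k Lk] := dim_v L'; rewrite (pairing_point_form x Lj) (pairing_point_form x Lk).
Qed.

Lemma TF_equiv_argmax (x y : 'rV[R]_n) :
  TF_equiv M (of_coord S x) (of_coord S y) <-> argmax v x = argmax v y.
Proof.
rewrite (TF_equiv_maximizes abC flC simS); split=> [H|e L].
  apply/setP => j; have [L Lj] := v_dim j.
  by apply/idP/idP => /(maximizes_argmax _ Lj)/H/(maximizes_argmax _ Lj).
by have [j Lj] := dim_v L; rewrite !(maximizes_argmax _ Lj) e.
Qed.

Lemma TF_argmax_classes : TF R S M = argmax_classes v.
Proof.
have E (x : 'rV[R]_n) : [set y | TF_equiv M (of_coord S x) (of_coord S y)] = argmax_class v x.
  apply/seteqP; split=> y; first by move=> /TF_equiv_argmax/esym.
  by move=> /esym/TF_equiv_argmax.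
by apply/seteqP; split=> _ [x ->]; exists x; rewrite E.
Qed.

End TFNormalFan.

Theorem theorem1p4 (R : realType) (A : preadd_cat) (abA : abelian A)
    (flA : finite_length A) (n : nat) (S : 'I_n -> A) (simS : simple_reps S)
    (M : A) :
  ([/\ rational_fan (Sigma R S M),
       finite_set (Sigma R S M)
     & complete_fan (Sigma R S M)] /\
   [/\ set_bij (TF R S M) (Sigma R S M) (fun E => closure E),
       set_bij (Sigma R S M) (TF R S M) (fun sigma => relint sigma),
       (forall E, TF R S M E -> relint (closure E) = E)
     & (forall sigma, Sigma R S M sigma -> closure (relint sigma) = sigma)])
  /\
  (forall sigma, Sigma R S M sigma ->
     [/\ sigma = \bigcup_(tau in Face sigma) relint tau,
         trivIset (Face sigma) (fun tau => relint tau)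
       & [set relint tau | tau in Face sigma] =
         [set E | TF R S M E /\ E `&` sigma !=set0]]).
Proof.
have [N [v [dim_v v_dim]]] := finite_dimvecs abA flA S M.
rewrite /Sigma (TF_argmax_classes abA R simS dim_v v_dim) -/(@normal_fan R n N v).
split; first split; [split|split|].
- exact: normal_fan_rational.
- exact: normal_fan_finite.
- exact: normal_fan_complete.
- exact: closure_bij.
- exact: relint_bij.
- exact: relint_closure_argmax_class.
- exact: closure_relint_normal_fan.
- exact: normal_fan_face_decomposition.
Qed.
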